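(* Let $\mathcal{C}$ be a class of piecewise expanding maps of $[0,1]$ such that: (1) $\mathcal{C}$ satisfies $(D_r)$ for some $r\ge 1$ and satisfies (Dec); (2) there exist $\lambda>1$ and $M\ge 1$ such that $\inf|T'|\ge\lambda$ and $\sup|T''|\le M$ for all $T\in\mathcal{C}$; (3) there exists $N\ge 1$ such that $\sharp\mathcal{A}_T\le N$ for all $T\in\mathcal{C}$. Let $(T_n)_{n\ge 1}$ be a sequence in $\mathcal{C}$ verifying the condition (Min). Then the process $(Z_n)_{n\ge 0}$ given by $Z_n=T_1^n$, defined on the probability space $([0,1],m)$, satisfies an exponential concentration inequality: there exists $C>0$ such that for all $n\ge 1$ and all separately Lipschitz functions $K:[0,1]^n\to\mathbb{R}$, $$\mathbb{E}_m\left(e^{K(Z_0,\ldots,Z_{n-1})-\mathbb{E}_m(K(Z_0,\ldots,Z_{n-1}))}\right)\le e^{C\sum_{j=0}^{n-1}\mathrm{Lip}_j(K)^2}.$$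
   Context: $m$ is Lebesgue measure on $[0,1]$ with its Borel $\sigma$-algebra; $\mathbb{E}_m$ is expectation with respect to $m$. A piecewise expanding map is a map $T:[0,1]\to[0,1]$ with $\inf_x|T'(x)|>1$ for which there is a finite partition $\mathcal{A}_T$ of $[0,1]$ into intervals with disjoint interiors such that $T$ can be extended to a $C^2$ map on a neighborhood of each element of $\mathcal{A}_T$. Its transfer operator $P_T:L^1(m)\to L^1(m)$ is characterized by $\int P_Tf\cdot g\,dm=\int f\cdot g\circ T\,dm$ for $f\in L^1(m)$, $g\in L^\infty(m)$; equivalently $P_Tf(x)=\sum_{Ty=x}f(y)/|T'(y)|$. For $f\in L^1(m)$, $\mathrm{V}f$ is the infimum of the total variations on $[0,1]$ of the functions $\bar f$ with $\bar f=f$ $m$-a.e.; $\mathrm{BV}=\{f\in L^1(m):\mathrm{V}f<\infty\}$ with norm $\|f\|_{\mathrm{BV}}=\mathrm{V}f+\|f\|_{L^1_m}$. $(D_r)$: a class $\mathcal{C}$ of piecewise expanding maps satisfies $(D_r)$, $r\ge1$ an integer, if there are constants $0<\rho_r<1$, $M_0>0$, $C_r>0$ such that $\|P_Tf\|_{\mathrm{BV}}\le M_0\|f\|_{\mathrm{BV}}$ for all $T\in\mathcal{C}$, $f\in\mathrm{BV}$, and $\|P_{T_r}\cdots P_{T_1}f\|_{\mathrm{BV}}\le\rho_r\|f\|_{\mathrm{BV}}+C_r\|f\|_{L^1_m}$ for all $T_1,\ldots,T_r\in\mathcal{C}$, $f\in\mathrm{BV}$. (Dec): $\mathcal{C}$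 satisfies (Dec) if there exist $0<\theta<1$ and $K_0>0$ such that for all $l\ge1$, all $T_1,\ldots,T_l\in\mathcal{C}$ and all $f\in\mathrm{BV}$ with $\int f\,dm=0$, $\|P_{T_l}\cdots P_{T_1}f\|_{\mathrm{BV}}\le K_0\theta^l\|f\|_{\mathrm{BV}}$. For a sequence $(T_n)_{n\ge1}$ and $n\le k$: $T_n^k=T_k\circ\cdots\circ T_n$, $P_n^k=P_{T_k}\cdots P_{T_n}$, and $T_1^0=\mathrm{Id}$. (Min): the sequence $(T_n)$ satisfies (Min) if there is $\delta>0$ with $P_1^n\mathbf{1}\ge\delta$ ($m$-a.e.) for all $n\ge1$. $K:[0,1]^n\to\mathbb{R}$ is separately Lipschitz if for each $i=0,\ldots,n-1$ there is a constant $\mathrm{Lip}_i(K)$ (taken to be the least such constant) with $|K(x_0,\ldots,x_i,\ldots,x_{n-1})-K(x_0,\ldots,x_i',\ldots,x_{n-1})|\le\mathrm{Lip}_i(K)|x_i-x_i'|$ for all points $x_0,\ldots,x_{n-1},x_i'\in[0,1]$. *)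

(* Defs.v *)
From HB Require Import structures.
From mathcomp Require Import all_boot all_order all_algebra.
From mathcomp Require Import all_classical all_reals all_analysis.
Set Implicit Arguments.
Unset Strict Implicit.
Unset Printing Implicit Defensive.
Import Order.TTheory GRing.Theory Num.Theory.
Import numFieldNormedType.Exports.
Local Open Scope classical_set_scope.
Local Open Scope ring_scope.

(* Maps of [0,1] are functions R -> R that are only
   evaluated on [0,1]; m is Lebesgue measure with integrals and a.e. statements
   taken over `[0, 1]. *)

Definition C2_on (R : realType) (U : set R) (g : R -> R) : Prop :=
  forall x, U x ->
    [/\ derivable g x 1, derivable (derive1 g) x 1 & {for x, continuous (derive1n 2 g)}].

(* The interiors of the elements of a finite family of intervals. T' and T''
   are only considered there: at the finitely many remaining points the
   one-sided limits may differ and the value of T is arbitrary. *)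
Definition pieces_interior (R : realType) (n : nat) (A : 'I_n -> interval R)
    : set R :=
  \bigcup_i interior [set` A i].

Record pexp_map (R : realType) := PexpMap {
  pe_map :> R -> R ;
  pe_card : nat ;
  pe_part : 'I_pe_card -> interval R ;
  pe_range : forall x, x \in `[0, 1] -> pe_map x \in `[0, 1] ;
  pe_cover : \bigcup_i [set` pe_part i] = `[0, 1]%classic ;
  pe_disjoint : trivIset setT (fun i => interior [set` pe_part i]) ;
  (* The extension of T|_{int I} is defined around the closed interval, so that
     it controls T up to both endpoints of I. *)
  pe_C2 : forall i, exists (U : set R) (g : R -> R),
    [/\ open U, closure [set` pe_part i] `<=` U, C2_on U g &
        forall x, interior [set` pe_part i] x -> pe_map x = g x] ;
  pe_expanding :
    (1 < ereal_inf [set `|derive1 pe_map x|%:E | x in pieces_interior pe_part])%E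
}.

Definition pe_dom (R : realType) (T : pexp_map R) : set R :=
  pieces_interior (@pe_part R T).

(* T is injective on each piece, so the sum is finite. *)
Definition transfer (R : realType) (T : pexp_map R) (f : R -> R) : R -> R :=
  fun x => \sum_(y \in [set y | pe_dom T y /\ T y = x]) (f y / `|derive1 T y|).

(* T_1^n = T_n \o ... \o T_1 and P_1^n = P_{T_n} ... P_{T_1}; the term T 0 is
   not used. *)
Fixpoint iter_map (R : realType) (T : nat -> pexp_map R) (n : nat) : R -> R :=
  if n is k.+1 then T k.+1 \o iter_map T k else id.

Fixpoint iter_transfer (R : realType) (T : nat -> pexp_map R) (n : nat)
    (f : R -> R) : R -> R :=
  if n is k.+1 then transfer (T k.+1) (iter_transfer T k f) else f.

Section BV.
Context {R : realType}.
Local Notation mu := (@lebesgue_measure R).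
Local Open Scope ereal_scope.

Definition variation (f : R -> R) : \bar R :=
  ereal_inf [set total_variation 0%R 1%R g | g in
    [set g : R -> R | {ae mu, forall x, x \in `[0%R, 1%R] -> g x = f x}]].

Definition L1norm (f : R -> R) : \bar R :=
  \int[mu]_(x in `[0%R, 1%R]) `|(f x)%:E|.

Definition BVnorm (f : R -> R) : \bar R := variation f + L1norm f.

Definition BV (f : R -> R) : Prop :=
  mu.-integrable `[0%R, 1%R] (EFin \o f) /\ variation f < +oo.

Definition cond_D (C : set (pexp_map R)) (r : nat) : Prop :=
  exists rho M0 Cr : R,
    [/\ (0 < rho < 1)%R, (0 < M0)%R, (0 < Cr)%R,
        forall (T : pexp_map R) (f : R -> R), C T -> BV f ->
          BVnorm (transfer T f) <= M0%:E * BVnorm f &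
        forall (T : nat -> pexp_map R) (f : R -> R),
          (forall k, (1 <= k <= r)%N -> C (T k)) -> BV f ->
          BVnorm (iter_transfer T r f) <= rho%:E * BVnorm f + Cr%:E * L1norm f].

Definition cond_Dec (C : set (pexp_map R)) : Prop :=
  exists theta K0 : R,
    [/\ (0 < theta < 1)%R, (0 < K0)%R &
        forall (l : nat) (T : nat -> pexp_map R) (f : R -> R),
          (1 <= l)%N -> (forall k, (1 <= k <= l)%N -> C (T k)) ->
          BV f -> \int[mu]_(x in `[0%R, 1%R]) (f x)%:E = 0 ->
          BVnorm (iter_transfer T l f) <= (K0 * theta ^+ l)%:E * BVnorm f].

Definition cond_Min (T : nat -> pexp_map R) : Prop :=
  exists2 delta : R, (0 < delta)%R &
    forall n : nat, (1 <= n)%N ->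
      {ae mu, forall x, x \in `[0%R, 1%R] ->
        (delta <= iter_transfer T n (cst 1%R) x)%R}.

End BV.

Definition lip_bound (R : realType) (n : nat) (K : 'rV[R]_n -> R) (i : 'I_n)
    (L : R) : Prop :=
  forall x y : 'rV[R]_n,
    (forall j, x 0 j \in `[0, 1]) -> (forall j, y 0 j \in `[0, 1]) ->
    (forall j, j != i -> x 0 j = y 0 j) ->
    `|K x - K y| <= L * `|x 0 i - y 0 i|.

Definition separately_lipschitz (R : realType) (n : nat) (K : 'rV[R]_n -> R)
    : Prop :=
  forall i : 'I_n, exists L : R, lip_bound K i L.

Definition Lip (R : realType) (n : nat) (K : 'rV[R]_n -> R) (i : 'I_n) : R :=
  inf [set L | lip_bound K i L].

(* The point (Z_0(x), ..., Z_{n-1}(x)), where Z_j = T_1^j. *)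
Definition process (R : realType) (T : nat -> pexp_map R) (n : nat) (x : R)
    : 'rV[R]_n :=
  \row_(j < n) iter_map T j x.

(* Main.v *)
(** The process is exposed backwards: let Y_p be the conditional expectation of
    K(Z_0, ..., Z_{n-1}) given Z_p (hence given Z_p, Z_{p+1}, ...).  It is an
    explicit quotient of transfer operators: it averages K over the inverse
    branches of T_1^p at Z_p, with the weights given by P_1^p.  The function
    x |-> K(Z_0 x, ..., Z_i x, u_{i+1}, ...) - K(Z_0 x, ..., Z_{i-1} x, u_i, ...)
    oscillates slowly along the inverse branches of T_1^i, so P_1^i maps it to a
    function whose BV norm is at most a constant times
    a_i = \sum_(j <= i) lambda^(j-i) Lip_j(K); this needs the sum of the sup
    norms of the branch weights to be bounded uniformly in i, which follows from
    (D_r), the distortion bound and the bound on the number of pieces.  By (Dec)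
    the centred increment then decays at rate theta under P_{i+1}^p, so that,
    using (Min), Y_p is within c \sum_(i < p) theta^(p-i) a_i of
    the mean of K(Z_0, ..., Z_{p-1}, u) evaluated at u = (Z_p, Z_{p+1}, ...).
    Hence |Y_p - Y_{p+1}| is bounded by some R_p, and e^s <= s + e^(3 s^2) gives
    E e^{Y_p} <= e^(3 R_p^2) E e^{Y_{p+1}}.  Young's inequality for
    convolutions bounds the sum of the R_p^2 by a constant times the sum of the
    Lip_j(K)^2. *)

From HB Require Import structures.
Require Import Defs.
From mathcomp Require Import all_boot all_order all_algebra.
From mathcomp Require Import all_classical all_reals all_analysis.
From mathcomp Require Import measurable_realfun ring lra.
Import Order.TTheory GRing.Theory Num.Theory.
Import numFieldNormedType.Exports.
Local Open Scope classical_set_scope.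
Local Open Scope ring_scope.
Set Implicit Arguments.
Unset Strict Implicit.
Unset Printing Implicit Defensive.

(** * Inequalities, variation and bounded measurable functions on [0,1] *)

(** The maps are not invertible, so the information carried by Z_p, Z_(p+1), ... decreases with p
    and a martingale is at hand only in reverse time. Two obstacles shape the rest. First, the
    number of branches of T_1^n may grow exponentially and lam is only known to exceed 1, so the
    crude count of branches times lam^(-n) is useless. A branch has surplus descendants only if an
    endpoint of a piece of T_(n+1) cuts its domain, and by bounded distortion the branches over one
    point have total weight at most a multiple of the density P_1^n 1 near it, which (D_r) bounds.
    Second, (Dec) gives for each frozen tail u an estimate with its own null set, but u is then
    replaced by the orbit of the point itself. Lipschitz dependence on u and a countable family of
    tails give one null set for all u. The inequality e^s <= s + e^(3 s^2) keeps the term s alone: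
    with s = Y_p - Y_(p+1), its integral against e^(Y_(p+1)) is zero. It holds for every real s, so
    the increments need not be small. *)

Lemma expR_le_sqr (R : realType) (s : R) : expR s <= s + expR (3 * s ^+ 2).
Proof.
have h2 : 1 + 3 * s ^+ 2 <= expR (3 * s ^+ 2) by exact: expR_ge1Dx.
(* From 1/3 on, s <= 3 s^2. Below 1/3, e^(-s/2) >= 1 - s/2 > 0 is squared and inverted, and the
   resulting rational bound lies under 1 + s + 3 s^2. *)
have [s1|s1] := leP (1/3) s.
  have : expR s <= expR (3 * s ^+ 2) by rewrite ler_expR; nra.
  lra.
have e0 := expR_gt0 s.
have h : expR s <= (1 - s / 2) ^- 2.
  rewrite -[expR s]invrK lef_pV2 ?posrE ?invr_gt0 ?exprn_gt0 ?subr_gt0; try lra.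
  rewrite -expRN (_ : - s = 2%:R * (- s / 2)); last by field.
  rewrite expRM_natl; apply: lerXn2r; rewrite ?nnegrE ?expR_ge0; try lra.
  by apply: le_trans (expR_ge1Dx _); lra.
suff : (1 - s / 2) ^- 2 <= 1 + s + 3 * s ^+ 2 by lra.
have hp : 0 < (1 - s/2) ^+ 2 by apply: exprn_gt0; lra.
rewrite -[X in X <= _]mul1r ler_pdivrMr //.
nra.
Qed.

#[local] Instance ae_lebesgue_filter (R : realType) :
  Filter (nbhs (almost_everywhere (@lebesgue_measure R))).
Proof. exact: ae_filter_ringOfSetsType. Qed.

Lemma lebesgue_measure01 (R : realType) :
  (@lebesgue_measure R) (`[0%R, 1%R]%classic : set R) = 1%E.
Proof. by rewrite lebesgue_measure_itv/= lte_fin ltr01 oppr0 adde0. Qed.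

(** Along a partition the increments of g are dominated by those of the nondecreasing G, which
    telescope. G may jump, so discontinuous g are covered too. *)
Lemma variation_le_mono (R : realType) (f g G : R -> R) :
  {ae @lebesgue_measure R, forall x, x \in `[0, 1] -> g x = f x} ->
  (forall x y, 0 <= x -> x <= y -> y <= 1 -> `|g y - g x| <= G y - G x) ->
  (Defs.variation f <= (G 1 - G 0)%:E)%E.
Proof.
move=> gf gG; apply: (@le_trans _ _ (total_variation 0 1 g)).
  by apply: ereal_inf_lbound; exists g.
apply: ge_ereal_sup => _ [_ [s s01 <-] <-]; rewrite lee_fin.
have Gnd : {in `[0, 1] &, nondecreasing_fun G}.
  move=> x y /[!in_itv]/= /andP[x0 x1] /andP[y0 y1] xy.
  by rewrite -subr_ge0; apply: le_trans (gG _ _ x0 xy y1).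
rewrite -(nondecreasing_variation Gnd s01) /variation.
rewrite !big_seq; apply: ler_sum => n /[!mem_index_iota] /andP[_ ns].
apply: le_trans (ler_norm _); apply: gG.
- by apply: (itv_partition_nth_ge _ s01); rewrite ltnS ltnW.
- by have [p _] := s01; have /pathP := p; move=> /(_ 1 n ns)/ltW.
- by apply: (itv_partition_nth_le _ s01); rewrite ltnS.
Qed.

Lemma osc_le_total_variation (R : realType) (g : R -> R) (x y : R) :
  0 <= x -> x <= 1 -> 0 <= y -> y <= 1 ->
  (`|g y - g x|%:E <= total_variation 0 1 g)%E.
Proof.
wlog xy : x y / x <= y => [H x0 x1 y0 y1|].
  by have [/H|/ltW /H] := leP x y; [apply|rewrite distrC; apply].
move=> x0 x1 y0 y1.
rewrite (total_variationD _ x0 x1) (total_variationD _ xy y1).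
apply: le_trans (total_variation_ge _ xy) _.
apply: (@le_trans _ _ (total_variation x y g + total_variation y 1 g)%E).
  by rewrite leeDl// total_variation_ge0.
by rewrite leeDr// total_variation_ge0.
Qed.

(** |f x| is at most the variation plus |f y|; integrate over y in [0, 1]. As the variation is an
    infimum over versions of f, one version gives this only up to e, and e then runs through
    1/(n+1). *)
Lemma ae_le_BVnorm (R : realType) (f : R -> R) (X : R) :
  measurable_fun (`[0, 1]%classic : set R) f -> (BVnorm f <= X%:E)%E ->
  {ae @lebesgue_measure R, forall x, x \in `[0, 1] -> `|f x| <= X}.
Proof.
move=> mf fX.
have mnf : measurable_fun (`[0, 1]%classic : set R) (abse \o (EFin \o f)).
  by apply: measurableT_comp => //; exact/measurable_EFinP.
have L0 : (0 <= L1norm f)%E by apply: integral_ge0.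
have V0 : (0 <= Defs.variation f)%E.
  by apply: le_ereal_inf_tmp => _ [g _ <-]; exact: total_variation_ge0.
have Lfin : L1norm f \is a fin_num.
  rewrite ge0_fin_numE//; apply: le_lt_trans (ltry X); apply: le_trans fX.
  by rewrite /BVnorm leeDr.
have main e : 0 < e ->
    {ae @lebesgue_measure R, forall x, x \in `[0, 1] -> `|f x| <= X + e}.
  move=> e0; set l := fine (L1norm f).
  have Ll : L1norm f = l%:E by rewrite /l fineK.
  have : (Defs.variation f < (X - l + e)%:E)%E.
    have Vfin : Defs.variation f \is a fin_num.
      rewrite ge0_fin_numE//; apply: le_lt_trans (ltry X); apply: le_trans fX.
      by rewrite /BVnorm leeDl.
    move: fX; rewrite /BVnorm Ll -(fineK Vfin) -EFinD !lee_fin !lte_fin; lra.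
  move=> /ereal_inf_lt[_ [g gf <-] gt].
  apply: filterS (gf) => x gfx x01; rewrite -(gfx x01).
  have : (\int[lebesgue_measure]_(y in `[0%R, 1%R]) `|g x|%:E <=
     \int[@lebesgue_measure R]_(y in `[0%R, 1%R]) ((X - l + e)%:E + `|(f y)%:E|))%E.
    apply: ae_ge0_le_integral => //.
    - move=> y y01; apply: adde_ge0 => //.
      apply: ltW; apply: le_lt_trans gt; exact: total_variation_ge0.
    - by apply: emeasurable_funD.
    - apply: filterS (gf) => y gfy y01.
      have [xa xb] : 0 <= x /\ x <= 1 by move: x01; rewrite in_itv => /andP.
      have [ya yb] : 0 <= y /\ y <= 1 by move: y01; rewrite /= in_itv => /andP.
      have := le_lt_trans (osc_le_total_variation g xa xb ya yb) gt.
      rewrite lte_fin -(gfy y01) -EFinD lee_fin => h.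
      have := ler_distD (g y) (g x) 0; rewrite !subr0 distrC => h2.
      by lra.
  rewrite integral_cst// ge0_integralD//; last first.
    by move=> y _; apply: ltW; apply: le_lt_trans gt; exact: total_variation_ge0.
  rewrite [X in (_ <= X + _)%E]integral_cst// -/(L1norm f) Ll.
  rewrite /= lebesgue_measure01 !mule1 -EFinD lee_fin.
  by rewrite addrAC subrK.
have : {ae @lebesgue_measure R, forall x, forall n : nat, x \in `[0, 1] -> `|f x| <= X + n.+1%:R^-1}.
  by apply: ae_foralln => n; exact: main.
apply: filterS => x H x01.
rewrite leNgt; apply/negP => /ltr_add_invr[n]; rewrite ltNge => /negP; apply.
exact: H.
Qed.

(** Convolution with a geometric kernel, \sum_(j < n) t^(n-1-j) a_j. With t = 1/lam, a = L and n =
    i+1 it is the a_i of the overview; with t = theta it sums the decaying increments. *)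
Fixpoint geo (R : realType) (t : R) (a : nat -> R) (n : nat) : R :=
  if n is k.+1 then t * geo t a k + a k else 0.

Lemma geo_ge0 (R : realType) (t : R) (a : nat -> R) n :
  0 <= t -> (forall i, 0 <= a i) -> 0 <= geo t a n.
Proof. by move=> t0 a0; elim: n => //= n IH; rewrite addr_ge0 ?mulr_ge0. Qed.

Lemma geoE (R : realType) (t : R) (a : nat -> R) n :
  geo t a n = \sum_(j < n) t ^+ (n.-1 - j) * a j.
Proof.
elim: n => [|n IH] /=; first by rewrite big_ord0.
rewrite big_ord_recr /= subnn mul1r IH mulr_sumr; congr (_ + _).
apply: eq_bigr => -[j jn] _ /=; rewrite mulrA -exprS; congr (_ ^+ _ * _).
by rewrite -subSn ?prednK//; [case: n jn {IH}|rewrite -ltnS prednK//; case: n jn {IH}].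
Qed.

(** Young's inequality for the kernel t^k, whose l^1 norm is 1/(1-t). *)
Lemma young_geo (R : realType) (t : R) (n : nat) (a : nat -> R) :
  0 < t < 1 ->
  \sum_(p < n.+1) geo t a p ^+ 2 <= (1 - t) ^- 2 * \sum_(i < n) a i ^+ 2.
Proof.
move=> /andP[t0 t1].
have u0 : 0 < 1 - t by lra.
(* The added term closes the induction: the step becomes (t b + x)^2/(1-t) <= t b^2/(1-t) +
   x^2/(1-t)^2, which is convexity of the square at b and x/(1-t). *)
suff : \sum_(p < n.+1) geo t a p ^+ 2 + t / (1 - t) * geo t a n ^+ 2 <=
    (1 - t) ^- 2 * \sum_(i < n) a i ^+ 2.
  apply: le_trans; rewrite lerDl mulr_ge0 ?sqr_ge0// divr_ge0 ?ltW//.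
elim: n => [|n IH].
  by rewrite big_ord_recr /= !big_ord0 expr0n /= !mulr0 !addr0.
rewrite big_ord_recr [X in _ <= _ * X]big_ord_recr /= mulrDr.
apply: le_trans (lerD IH (lexx _)).
rewrite -!addrA lerD2l.
set b := geo t a n; set x := a n.
rewrite -(ler_pM2l (exprn_gt0 2 u0)) !mulrDr.
rewrite (_ : (1 - t) ^+ 2 * (t / (1 - t) * (t * b + x) ^+ 2) = (1 - t) * t * (t * b + x) ^+ 2); last first.
  by field; rewrite gt_eqF.
rewrite (_ : (1 - t) ^+ 2 * (t / (1 - t) * b ^+ 2) = (1 - t) * t * b ^+ 2); last first.
  by field; rewrite gt_eqF.
rewrite mulVKf ?expf_neq0 ?gt_eqF//.
have := mulr_ge0 (ltW t0) (sqr_ge0 ((1 - t) * b - x)); lra.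
Qed.

(** The bound holds at every point of [0, 1], which makes the class stable under composition with
    inverse branches, hence under transfer operators; all integrals are then finite. *)
Definition bmeas (R : realType) (f : R -> R) : Prop :=
  measurable_fun (`[0, 1]%classic : set R) f /\
  exists B, forall x, x \in `[0, 1] -> `|f x| <= B.

Definition Ex (R : realType) (f : R -> R) : R :=
  \int[@lebesgue_measure R]_(x in `[0%R, 1%R]) f x.

Section bounded_measurable.
Context {R : realType}.
Implicit Types f g : R -> R.
Local Notation mu := (@lebesgue_measure R).

Lemma bmeas_cst (c : R) : bmeas (fun=> c).
Proof. by split; [exact: measurable_cst|exists `|c|]. Qed.

Lemma bmeasD f g : bmeas f -> bmeas g -> bmeas (fun x => f x + g x).
Proof.
move=> [mf [B fB]] [mg [C gC]]; split; first exact: measurable_funD.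
exists (B + C) => x x01; apply: le_trans (ler_normD _ _) _.
by rewrite lerD ?fB ?gC.
Qed.

Lemma bmeasM f g : bmeas f -> bmeas g -> bmeas (fun x => f x * g x).
Proof.
move=> [mf [B fB]] [mg [C gC]]; split; first exact: measurable_funM.
by exists (B * C) => x x01; rewrite normrM ler_pM ?fB ?gC.
Qed.

Lemma bmeasN f : bmeas f -> bmeas (fun x => - f x).
Proof.
move=> [mf [B fB]]; split; first exact: measurableT_comp.
by exists B => x x01; rewrite normrN fB.
Qed.

Lemma bmeasB f g : bmeas f -> bmeas g -> bmeas (fun x => f x - g x).
Proof. by move=> ff gg; apply: bmeasD => //; exact: bmeasN. Qed.

Lemma bmeas_sum (I : Type) (s : seq I) (F : I -> R -> R) :
  (forall i, bmeas (F i)) -> bmeas (fun x => \sum_(i <- s) F i x).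
Proof.
move=> bF; elim: s => [|i s IH].
  by under eq_fun do rewrite big_nil; exact: bmeas_cst.
by under eq_fun do rewrite big_cons; exact: bmeasD.
Qed.

Lemma bmeas_expR f : bmeas f -> bmeas (fun x => expR (f x)).
Proof.
move=> [mf [B fB]]; split; first exact: measurableT_comp.
exists (expR B) => x x01; rewrite ger0_norm ?expR_ge0// ler_expR.
exact: le_trans (ler_norm _) (fB x x01).
Qed.

Lemma eq_bmeas f g : (forall x, x \in `[0, 1] -> f x = g x) ->
  bmeas f -> bmeas g.
Proof.
move=> fg [mf [B fB]]; split; last by exists B => x x01; rewrite -fg// fB.
by apply: eq_measurable_fun mf => x /[!inE]; exact: fg.
Qed.

Lemma bmeas_integrable f : bmeas f -> mu.-integrable `[0, 1] (EFin \o f).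
Proof.
move=> [mf [B fB]]; apply: measurable_bounded_integrable => //.
  by rewrite /= lebesgue_measure01 ltry.
exists B; split; first by rewrite num_real.
move=> C BC x /= x01; apply: le_trans (fB x x01) (ltW BC).
Qed.

Lemma Ex_int f : bmeas f ->
  (\int[mu]_(x in `[0%R, 1%R]) (f x)%:E = (Ex f)%:E)%E.
Proof.
move=> bf; rewrite /Ex /Rintegral fineK//.
exact: integrable_fin_num (bmeas_integrable bf).
Qed.

Lemma Ex_cst (c : R) : Ex (fun=> c) = c.
Proof. by rewrite /Ex Rintegral_cst//= lebesgue_measure01 mulr1. Qed.

Lemma ExD f g : bmeas f -> bmeas g -> Ex (fun x => f x + g x) = Ex f + Ex g.
Proof. by move=> bf bg; apply: RintegralD => //; exact: bmeas_integrable. Qed.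

Lemma ExB f g : bmeas f -> bmeas g -> Ex (fun x => f x - g x) = Ex f - Ex g.
Proof. by move=> bf bg; apply: RintegralB => //; exact: bmeas_integrable. Qed.

Lemma ExZ (c : R) f : bmeas f -> Ex (fun x => c * f x) = c * Ex f.
Proof. by move=> bf; apply: RintegralZl => //; exact: bmeas_integrable. Qed.

Lemma eq_Ex f g : (forall x, x \in `[0, 1] -> f x = g x) -> Ex f = Ex g.
Proof. by move=> fg; apply: eq_Rintegral => x /[!inE]; exact: fg. Qed.

Lemma le_Ex f g : bmeas f -> bmeas g ->
  {ae mu, forall x, x \in `[0, 1] -> f x <= g x} -> Ex f <= Ex g.
Proof.
move=> bf bg fg; rewrite -subr_ge0 -ExB// -lee_fin -Ex_int; last exact: bmeasB.
have [mfg _] := bmeasB bg bf.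
have -> : (\int[mu]_(x in `[0%R, 1%R]) (g x - f x)%:E =
    \int[mu]_(x in `[0%R, 1%R]) (Num.max 0%R (g x - f x)%R)%:E)%E.
  apply: ae_eq_integral => //.
  - exact/measurable_EFinP.
  - by apply/measurable_EFinP; apply: measurable_maxr.
  - apply: filterS fg => x fg x01; congr EFin; apply/esym/max_r.
    by rewrite subr_ge0 fg.
by apply: integral_ge0 => x _; rewrite lee_fin le_max lexx.
Qed.

Lemma norm_Ex_le f (B : R) : bmeas f ->
  (forall x, x \in `[0, 1] -> `|f x| <= B) -> `|Ex f| <= B.
Proof.
move=> bf fB.
have h x : x \in `[0, 1] -> - B <= f x <= B by move/fB; rewrite ler_norml.
rewrite ler_norml; apply/andP; split.
  rewrite -[X in X <= _]Ex_cst.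
  by apply: le_Ex => //; [exact: bmeas_cst|apply: aeW => x /h/andP[]].
rewrite -[X in _ <= X]Ex_cst.
by apply: le_Ex => //; [exact: bmeas_cst|apply: aeW => x /h/andP[]].
Qed.

End bounded_measurable.

(** * Change of variables *)

Section weighted_pullback.
Context {R : realType} (w : measurableTypeR R -> R) (sg : measurableTypeR R -> measurableTypeR R).
Hypothesis w_ge0 : forall x, 0 <= w x.
Hypothesis mw : measurable_fun (setT : set (measurableTypeR R)) w.
Hypothesis msg : measurable_fun (setT : set (measurableTypeR R)) sg.
Local Notation mu := (@lebesgue_measure R).
Local Open Scope ereal_scope.

(** The image under [sg] of the measure w dm on [0, 1]. For an inverse branch with weight 1/|T'|
    this is Lebesgue measure on the piece. *)
Definition wpull (A : set (measurableTypeR R)) : \bar R :=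
  \int[mu]_(x in `[0%R, 1%R]) ((w x)%:E * (\1_A (sg x))%:E).

Let wpull0 : wpull set0 = 0.
Proof. by rewrite /wpull integral0_eq// => x _; rewrite indicE in_set0 mule0. Qed.

Let wpull_ge0 A : 0 <= wpull A.
Proof. by apply: integral_ge0 => x _; rewrite mule_ge0// lee_fin. Qed.

Let mterm (f : measurableTypeR R -> \bar R) (D : set (measurableTypeR R)) : measurable_fun (setT : set (measurableTypeR R)) f ->
  measurable_fun D (fun x => (w x)%:E * f (sg x)).
Proof.
move=> mf; apply: (measurable_funS measurableT) => //.
apply: emeasurable_funM; first exact/measurable_EFinP.
exact: measurableT_comp.
Qed.

Let mindic (A : set (measurableTypeR R)) : measurable A ->
  measurable_fun (setT : set (measurableTypeR R)) (fun x => (\1_A x : R)%:E).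
Proof. by move=> mA; apply/measurable_EFinP; exact: measurable_indic. Qed.

Let wpull_sigma_additive :
  semi_sigma_additive wpull.
Proof.
move=> /= F mF tF mUF; apply: cvg_toP.
  apply: ereal_nondecreasing_is_cvgn => m n mn.
  apply: lee_sum_nneg_natr => // k _ _; exact: wpull_ge0.
rewrite /wpull -integral_nneseries//=.
- apply: eq_integral => x _.
  rewrite nneseriesZl; last by move=> i _; rewrite lee_fin.
  by rewrite -indic_bigcup.
- move=> n; apply: (mterm (f := fun x => (\1_(F n : set (measurableTypeR R)) x)%:E)).
  exact: (mindic (mF n)).
- by move=> n x _; rewrite mule_ge0// lee_fin.
Qed.

HB.instance Definition _ := isMeasure.Build _ _ _ wpull
  wpull0 wpull_ge0 wpull_sigma_additive.

Definition wpull_measure : {measure set (measurableTypeR R) -> \bar R} :=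
  wpull.

Import HBNNSimple.

Let integral_wpull_nnsfun (f : {nnsfun (measurableTypeR R) >-> R}) :
  \int[wpull]_x (f x)%:E =
  \int[mu]_(x in `[0%R, 1%R]) ((w x)%:E * (f (sg x))%:E).
Proof.
under [LHS]eq_integral do rewrite fimfunE -fsumEFin//.
rewrite [LHS]ge0_integral_fsum//; last 2 first.
  - by move=> r; exact/measurable_EFinP/measurableT_comp.
  - by move=> n x _; rewrite EFinM nnfun_muleindic_ge0.
under [RHS]eq_integral.
  move=> x xD; rewrite fimfunE -fsumEFin// ge0_mule_fsumr; last first.
    by move=> r; rewrite EFinM nnfun_muleindic_ge0.
  over.
rewrite [RHS]ge0_integral_fsum//; last 2 first.
  - move=> r; apply: (mterm (f := fun x => (r * \1_(f @^-1` [set r]) x)%:E)).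
    by apply/measurable_EFinP/measurableT_comp.
  - move=> n x _; rewrite mule_ge0 ?lee_fin//.
    by have := nnfun_muleindic_ge0 f n (sg x); rewrite -EFinM lee_fin.
apply: eq_fsbigr => r _.
rewrite integralZl_indic_nnsfun//= integral_indic//= setIT /wpull.
have [r0|r0] := ltP r 0%R.
  rewrite preimage_nnfun0//.
  by rewrite !integral0_eq ?mule0// => x _; rewrite indicE in_set0 ?mulr0 mule0.
rewrite -ge0_integralZl//.
- by apply: eq_integral => x _; rewrite EFinM muleCA.
- by apply: (mterm (f := fun x => (\1_(f @^-1` [set r]) x)%:E)); apply: mindic.
- by move=> x _; rewrite mule_ge0// lee_fin.
Qed.

Lemma ge0_integral_wpull (f : measurableTypeR R -> \bar R) :
  measurable_fun (setT : set (measurableTypeR R)) f -> (forall x, 0 <= f x) ->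
  \int[wpull]_x f x = \int[mu]_(x in `[0%R, 1%R]) ((w x)%:E * f (sg x)).
Proof.
move=> mf f0.
pose f_ := nnsfun_approx measurableT mf.
transitivity (lim (\int[wpull]_x (f_ n x)%:E @[n --> \oo])).
  rewrite -monotone_convergence//=.
  - apply: eq_integral => ? /[!inE] xD; apply/esym/cvg_lim => //=.
    exact: cvg_nnsfun_approx.
  - by move=> n; exact/measurable_EFinP/measurable_funTS.
  - by move=> n ? _; rewrite lee_fin.
  - by move=> ? _ ? ? mn; rewrite lee_fin; exact/lefP/nd_nnsfun_approx.
rewrite [RHS](_ : _ = lim
    (\int[mu]_(x in `[0%R, 1%R]) ((w x)%:E * (f_ n (sg x))%:E) @[n --> \oo])); last first.
  rewrite -monotone_convergence//=.
  - apply: eq_integral => x _; apply/esym/cvg_lim => //.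
    apply: cvgeZl => //; exact: cvg_nnsfun_approx.
  - move=> n; apply: (mterm (f := fun x => (f_ n x)%:E)).
    exact/measurable_EFinP/measurable_funTS.
  - by move=> n ? _; rewrite mule_ge0// lee_fin.
  - move=> x _ m n mn; apply: lee_pmul => //; rewrite ?lee_fin//.
    exact/lefP/nd_nnsfun_approx.
by apply: congr_lim; apply/funext => n /=; exact: integral_wpull_nnsfun.
Qed.

End weighted_pullback.

(** By uniqueness of Lebesgue measure it suffices to know the image measure on half-open intervals.
    Uniqueness concerns measures on the whole line, so the image measure, carried by ]a, b[, is
    completed by Lebesgue measure outside ]a, b[. *)
Lemma integral_change_of_variables (R : realType) (w sg : R -> R) (a b : R) :
  a < b ->
  (forall x, 0 <= w x) ->
  measurable_fun (setT : set R) w -> measurable_fun (setT : set R) sg ->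
  (forall x, w x != 0 -> a < sg x < b) ->
  (forall c d, a <= c -> c < d -> d <= b ->
     (wpull w sg `]c, d] = (d - c)%:E)%E) ->
  forall f : R -> \bar R,
  measurable_fun (`]a, b[%classic : set R) f ->
  (forall x, x \in `]a, b[ -> (0 <= f x)%E) ->
  (\int[@lebesgue_measure R]_(x in `[0%R, 1%R]) ((w x)%:E * f (sg x)) =
   \int[@lebesgue_measure R]_(x in `]a, b[) f x)%E.
Proof.
move=> ab w0 mw ms ws H f mf f0.
have mfI : measurable_fun (setT : set R) (f \_ `]a, b[).
  by apply/(measurable_restrictT _ _).1.
have fI0 x : (0 <= (f \_ `]a, b[) x)%E.
  by rewrite patchE; case: ifPn => // /[!inE]; exact: f0.
transitivity (\int[@lebesgue_measure R]_(x in `[0%R, 1%R]) ((w x)%:E * (f \_ `]a, b[) (sg x)))%E.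
  apply: eq_integral => x _; have [->|wx] := eqVneq (w x) 0; first by rewrite !mul0e.
  by rewrite patchE mem_set//= in_itv/= ws.
rewrite -(ge0_integral_wpull w0 mw ms)// -integral_mkcond.
apply: eq_measure_integral => A mA AI.
have mI : measurable (~` `]a, b[%classic : set (measurableTypeR R)).
  exact: measurableC (measurable_itv _).
pose nu : {measure set (measurableTypeR R) -> \bar R} :=
  measure_add (wpull_measure w0 mw ms) (mrestr (@lebesgue_measure R) mI).
have nuE (B : set R) : nu B =
    (wpull w sg B + (@lebesgue_measure R) (B `&` ~` `]a, b[))%E.
  exact: (measure_addE (wpull_measure w0 mw ms) (mrestr (@lebesgue_measure R) mI) B).
change (wpull w sg A = @lebesgue_measure R A).
suff -> : @lebesgue_measure R A = nu A.
  rewrite nuE (_ : A `&` _ = set0) ?measure0 ?adde0//.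
  by apply/seteqP; split => // x [/AI Ix].
apply: lebesgue_measure_unique mA => _ [[c d] _ <-] /=.
rewrite nuE.
have mcd : measurable (`]c, d]%classic : set (measurableTypeR R)) by exact: measurable_itv.
rewrite (measureDI lebesgue_measure mcd (measurable_itv `]a, b[)) setDE addeC.
congr (_ + _)%E.
have [cd|dc] := ltP (Num.max c a) (Num.min d b); last first.
  rewrite (_ : _ `&` _ = set0); last first.
    apply/seteqP; split => // x [] /=; rewrite !in_itv/= => /andP[cx xd] /andP[ax xb].
    by move: dc; rewrite leNgt gt_max !lt_min => /negP; apply;
      rewrite (lt_le_trans cx)// (lt_trans cx xb) (lt_le_trans ax)// (lt_trans ax xb).
  rewrite measure0 /wpull integral0_eq// => x _.
  have [->|/ws/andP[ax xb]] := eqVneq (w x) 0; first by rewrite mul0e.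
  rewrite indicE memNset ?mule0//= in_itv/= => /andP[cx xd].
  by move: dc; rewrite leNgt gt_max !lt_min => /negP; apply;
      rewrite (lt_le_trans cx)// (lt_trans cx xb) (lt_le_trans ax)// (lt_trans ax xb).
rewrite (_ : wpull w sg _ = wpull w sg `]Num.max c a, Num.min d b]); last first.
  apply: eq_integral => x _.
  have [->|/ws/andP[ax xb]] := eqVneq (w x) 0; first by rewrite !mul0e.
  congr (_ * (_)%:E)%E; rewrite !indicE; congr (_%:R); congr nat_of_bool.
  by apply/idP/idP; rewrite !inE/= !in_itv/= gt_max le_min ax (ltW xb) !andbT.
rewrite H ?le_max ?lexx ?orbT// ?ge_min ?lexx ?orbT//.
have [db|bd] := ltP d b.
  rewrite (_ : _ `&` _ = `]Num.max c a, Num.min d b]%classic); last first.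
    apply/seteqP; split => x /=; rewrite !in_itv/= gt_max le_min.
      by move=> [/andP[-> ->] /andP[-> /ltW ->]].
    move=> /andP[/andP[-> ->] /andP[xd xb]]; split => //.
    by rewrite (le_lt_trans xd).
  by rewrite /= lebesgue_measure_itv/= lte_fin cd -EFinB ?(min_l (ltW db)).
rewrite (_ : _ `&` _ = `]Num.max c a, Num.min d b[%classic); last first.
  apply/seteqP; split => x /=; rewrite !in_itv/= gt_max lt_min.
    by move=> [/andP[-> _] /andP[-> xb]]; rewrite xb (lt_le_trans xb bd).
  by move=> /andP[/andP[-> ->] /andP[/ltW -> ->]].
by rewrite /= lebesgue_measure_itv/= lte_fin cd -EFinB ?(min_r bd).
Qed.

(** * Smooth inverse branches *)

Lemma lipschitz_continuous (R : realType) (f : R -> R) (K : R) :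
  (forall x y, `|f x - f y| <= K * `|x - y|) -> continuous f.
Proof.
move=> fK x; apply/cvgrPdist_le => e e0.
have K1 : 0 < `|K| + 1 by rewrite ltr_wpDl.
near=> y.
apply: le_trans (fK x y) _.
have : `|x - y| <= e / (`|K| + 1).
  by near: y; apply: cvgr_dist_le => //; rewrite divr_gt0.
rewrite ler_pdivlMr// => h; apply: le_trans h; rewrite mulrC ler_wpM2l//.
by rewrite (le_trans (ler_norm _))// lerDl.
Unshelve. all: by end_near. Qed.

Lemma clamp_lipschitz (R : realType) (l u x y : R) :
  `|Num.max l (Num.min u x) - Num.max l (Num.min u y)| <= `|x - y|.
Proof.
wlog xy : x y / x <= y.
  move=> H; have [/H//|/ltW/H] := leP x y.
  by rewrite distrC (distrC y).
have h : Num.max l (Num.min u x) <= Num.max l (Num.min u y).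
  by rewrite ge_max !le_max lexx/= le_min !ge_min lexx xy !orbT.
rewrite distrC (distrC x) !ger0_norm ?subr_ge0//.
rewrite lerBlDr ge_max; apply/andP; split.
  apply: (@le_trans _ _ (Num.max l (Num.min u x))); first by rewrite le_max lexx.
  by rewrite lerDr subr_ge0.
rewrite ge_min; have [ux|xu] := leP u x.
  apply/orP; left; apply: (@le_trans _ _ (Num.max l u)); first by rewrite le_max lexx orbT.
  by rewrite lerDr subr_ge0.
apply/orP; right.
rewrite (_ : y - x + _ = y + (Num.max l x - x)); last by rewrite addrAC addrA.
by rewrite lerDl subr_ge0 le_max lexx orbT.
Qed.

(** [sg] and [w] are total, and [w] vanishes off the image of ]a, b[, so that sums over branches
    carry no domain conditions. [ib_image] is what lets domains of composed branches stay intervals;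
    b <= a is allowed and forces w = 0. *)
Record inverse_branch (R : realType) (T : R -> R) (a b lam dl : R)
    (sg w : R -> R) : Prop := InverseBranch {
  ib_w_ge0 : forall x, 0 <= w x;
  ib_mw : measurable_fun (setT : set R) w;
  ib_msg : measurable_fun (setT : set R) sg;
  ib_sg01 : forall x, sg x \in `[0, 1];
  ib_supp : forall x, w x != 0 -> a < sg x < b /\ T (sg x) = x;
  ib_w : forall y, a < y < b -> w (T y) = `|derive1 T y|^-1;
  ib_sg : forall y, a < y < b -> sg (T y) = y;
  ib_image : forall l u, a <= l -> l < u -> u <= b ->
    exists p : R * R, p.1 < p.2 /\
      forall x, p.1 < x < p.2 <-> exists2 y, l < y < u & T y = x;
  ib_contr : forall y z, a < y < b -> a < z < b ->
    `|y - z| <= lam^-1 * `|T y - T z|;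
  ib_dist : forall y z, a < y < b -> a < z < b ->
    w (T y) <= w (T z) * expR (dl * `|T y - T z|);
  ib_int : forall f : R -> \bar R,
    measurable_fun (`]a, b[%classic : set R) f ->
    (forall x, x \in `]a, b[ -> (0 <= f x)%E) ->
    (\int[@lebesgue_measure R]_(x in `[0%R, 1%R]) ((w x)%:E * f (sg x)) =
     \int[@lebesgue_measure R]_(x in `]a, b[) f x)%E
}.

Section smooth_piece.
Context {R : realType} (T g : R -> R) (U : set R) (a b lam M : R).
Hypotheses (a0 : 0 <= a) (ab : a < b) (b1 : b <= 1) (lam1 : 1 < lam)
  (gU : forall x, x \in `[a, b] -> U x) (gC2 : C2_on U g)
  (Tg : forall x, x \in `]a, b[ -> T x = g x)
  (dT : forall x, x \in `]a, b[ -> lam <= `|derive1 T x|)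
  (ddT : forall x, x \in `]a, b[ -> `|derive1n 2 T x| <= M).

Local Notation d := (derive1 g).

Let ooW x : x \in `]a, b[ -> x \in `[a, b].
Proof. exact: subset_itv_oo_cc. Qed.

Lemma piece_derive1 x : x \in `]a, b[ -> derive1 T x = d x.
Proof.
move=> xab; rewrite !derive1E; apply: near_eq_derive.
by near=> y; apply: Tg; near: y; exact: near_in_itvoo.
Unshelve. all: by end_near. Qed.

Let ge_lam x : x \in `]a, b[ -> lam <= `|d x|.
Proof. by move=> xab; rewrite -piece_derive1// dT. Qed.

Let le_M x : x \in `]a, b[ -> `|derive1 d x| <= M.
Proof.
move=> xab; apply: le_trans (ddT xab); rewrite /derive1n /=.
rewrite !(derive1E _ x) (@near_eq_derive _ _ _ d (derive1 T) x)//.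
by near=> y; rewrite piece_derive1//; near: y; exact: near_in_itvoo.
Unshelve. all: by end_near. Qed.

Let M_ge0 : 0 <= M.
Proof.
have m : (a + b) / 2 \in `]a, b[ by have h := ab; rewrite in_itv/=; apply/andP; split; lra.
exact: le_trans (normr_ge0 _) (le_M m).
Qed.

Let dg x : x \in `[a, b] -> is_derive x 1 g (d x).
Proof. by move=> /gU /gC2[h _ _]; rewrite derive1E; exact: derivableP. Qed.

Let ddg x : x \in `[a, b] -> is_derive x 1 d (derive1 d x).
Proof. by move=> /gU /gC2[_ h _]; rewrite derive1E; exact: derivableP. Qed.

Let cont_at (f f' : R -> R) (x : R) : is_derive x 1 f (f' x) -> {for x, continuous f}.
Proof.
by move=> fx; apply: differentiable_continuous; apply/derivable1_diffP.
Qed.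

Let cont_within (f f' : R -> R) c e :
  (forall x, x \in `[a, b] -> is_derive x 1 f (f' x)) ->
  a <= c -> e <= b -> {within `[c, e], continuous f}.
Proof.
move=> ff' ac eb; apply: continuous_in_subspaceT => x /[!inE]/= /[!in_itv]/= /andP[cx xe].
by apply: (@cont_at _ f'); apply: ff'; rewrite in_itv/= (le_trans ac)// (le_trans xe).
Qed.

Let MVTle (f f' : R -> R) x y :
  (forall x, x \in `[a, b] -> is_derive x 1 f (f' x)) ->
  a <= x -> x < y -> y <= b ->
  exists2 c, c \in `]a, b[ & f y - f x = f' c * (y - x).
Proof.
move=> ff' ax xy yb.
have H1 : forall z : R, z \in `]x, y[ -> is_derive z 1 f (f' z).
  move=> z; rewrite in_itv/= => /andP[xz zy]; apply: ff'; rewrite in_itv/=.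
  by rewrite (le_trans ax (ltW xz)) (le_trans (ltW zy)).
have [c cxy e] := MVT xy H1 (cont_within ff' ax yb).
exists c => //; move: cxy; rewrite !in_itv/= => /andP[xc cy].
by rewrite (le_lt_trans ax xc) (lt_le_trans cy yb).
Qed.

(** A change of sign would give a zero of g' by the intermediate value theorem, against |g'| >=
    lam. *)
Let sign_pos x y : x \in `]a, b[ -> y \in `]a, b[ -> 0 < d x -> 0 < d y.
Proof.
move=> xab yab dx; rewrite ltNge; apply/negP => dy.
have key z t : z \in `]a, b[ -> t \in `]a, b[ -> z <= t ->
    Num.min (d z) (d t) <= 0 <= Num.max (d z) (d t) -> False.
  move=> zab tab zt h.
  have [|c czt dc] := IVT zt _ h.
    by apply: (@cont_within d (derive1 d) z t ddg); rewrite ?(itvP zab) ?(itvP tab).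
  have cab : c \in `]a, b[.
    move: czt; rewrite !in_itv/= => /andP[zc ct].
    by rewrite (lt_le_trans _ zc) ?(itvP zab)// (le_lt_trans ct)// (itvP tab).
  by have := ge_lam cab; rewrite dc normr0 leNgt (lt_trans _ lam1).
have [xy|/ltW yx] := leP x y.
  by apply: (key x y) => //; rewrite ge_min dy orbT le_max (ltW dx).
by apply: (key y x) => //; rewrite ge_min dy le_max (ltW dx) orbT.
Qed.

(** With the orientation s, increasing and decreasing pieces are treated together through the
    increasing map s * g. *)
Lemma piece_sign : exists2 s : R, s = 1 \/ s = -1 &
  forall x, x \in `]a, b[ -> lam <= s * d x.
Proof.
have m : (a + b) / 2 \in `]a, b[ by have h := ab; rewrite in_itv/=; apply/andP; split; lra.
have := ge_lam m; have [dm h|dm h] := ltP 0 (d ((a + b) / 2)).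
  exists 1; [by left|move=> x xab]; have := ge_lam xab; rewrite mul1r.
  by rewrite gtr0_norm// (sign_pos m).
exists (-1); [by right|move=> x xab]; have := ge_lam xab; rewrite mulN1r.
rewrite ler0_norm// leNgt; apply/negP => dx.
by move: dm; rewrite leNgt (sign_pos xab).
Qed.

Section monotone_branch.
Variable s : R.
Hypotheses (s1 : s = 1 \/ s = -1)
  (sd : forall x, x \in `]a, b[ -> lam <= s * d x).

Let ss : s * s = 1.
Proof. by case: s1 => ->; rewrite ?mulrNN mulr1. Qed.

Let expand_abs x y : x \in `[a, b] -> y \in `[a, b] ->
  lam * `|x - y| <= `|g x - g y|.
Proof.
wlog xy : x y / x < y => [H xab yab|].
  have [xy|yx|->] := ltgtP x y; [exact: H| |by rewrite !subrr !normr0 mulr0].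
  by rewrite distrC (distrC (g x)); apply: H.
rewrite !in_itv/= => /andP[ax xb] /andP[ay yb].
have [c cab e] := MVTle dg ax xy yb.
rewrite [leLHS](_ : _ = lam * `|y - x|); last by rewrite distrC.
by rewrite [leRHS]distrC e normrM ler_wpM2r// ge_lam.
Qed.

Let expand x y : a <= x -> x < y -> y <= b -> lam * (y - x) <= s * (g y - g x).
Proof.
move=> ax xy yb; have [c cab ->] := MVTle dg ax xy yb.
by rewrite mulrA ler_wpM2r ?sd// subr_ge0 ltW.
Qed.

Let smono x y : a <= x -> x < y -> y <= b -> s * g x < s * g y.
Proof.
move=> ax xy yb; rewrite -subr_gt0 -mulrBr.
apply: lt_le_trans (expand ax xy yb).
by rewrite mulr_gt0 ?subr_gt0// (lt_trans _ lam1).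
Qed.

Let sinj x y : x \in `[a, b] -> y \in `[a, b] -> g x = g y -> x = y.
Proof.
rewrite !in_itv/= => /andP[ax xb] /andP[ay yb] gxy.
have [xy|yx|//] := ltgtP x y.
  by have := smono ax xy yb; rewrite gxy ltxx.
by have := smono ay yx xb; rewrite gxy ltxx.
Qed.

Let scont c e : a <= c -> e <= b -> {within `[c, e], continuous (fun x => s * g x)}.
Proof.
apply: (@cont_within _ (fun x => s * d x)) => x /dg xd.
exact: is_deriveZ.
Qed.

(* The image of a subinterval, described through the increasing map [s * g]. *)
Let simage l u x : a <= l -> l < u -> u <= b ->
  (s * g l < s * x < s * g u) <-> (exists2 y, l < y < u & g y = x).
Proof.
move=> al lu ub; split=> [/andP[h1 h2]|[y /andP[ly yu] <-]]; last first.
  by rewrite !smono// ?(le_trans al (ltW ly))// (le_trans (ltW yu)).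
have [||y] := @IVT R (fun x => s * g x) l u (s * x) (ltW lu).
- exact: scont.
- by rewrite ge_min (ltW h1) le_max (ltW h2) orbT.
rewrite in_itv/= => /andP[ly yu] e; exists y; last first.
  by rewrite -[g y]mul1r -ss -mulrA e mulrA ss mul1r.
rewrite !lt_neqAle ly yu !andbT; apply/andP; split; apply/negP => /eqP h.
  by move: h1; rewrite h e ltxx.
by move: h2; rewrite -h e ltxx.
Qed.

Let L0 := Num.min (g a) (g b).
Let U0 := Num.max (g a) (g b).
(** Clamping to the image first makes the inverse and its weight Lipschitz on the whole line; their
    measurability then follows from continuity. *)
Let clamp (x : R) := Num.max L0 (Num.min U0 x).
Let ginv (x : R) : R := xget a [set y | y \in `[a, b] /\ g y = x].

Let ginvK y : y \in `[a, b] -> ginv (g y) = y.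
Proof.
move=> yab; rewrite /ginv; case: xgetP => [z -> [zab gzy]|].
  exact: sinj.
by move=> /(_ y); case; split.
Qed.

Let clampK x : L0 <= x <= U0 -> clamp x = x.
Proof.
by move=> /andP[h1 h2]; rewrite /clamp (min_r h2) (max_r h1).
Qed.

Let clamp_img x : exists2 y, y \in `[a, b] & g y = clamp x.
Proof.
apply: (IVT (ltW ab)); first exact: (cont_within dg).
have LU : L0 <= U0 by apply: (@le_trans _ _ (g a)); rewrite ?ge_min ?le_max lexx.
rewrite -/L0 -/U0; apply/andP; split; first by rewrite [leRHS]/clamp le_max lexx.
by rewrite [leLHS]/clamp ge_max LU/= ge_min lexx.
Qed.

Let dlip x y : x \in `[a, b] -> y \in `[a, b] -> `|d x - d y| <= M * `|x - y|.
Proof.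
wlog xy : x y / x <= y.
  move=> H xab yab; have [xy|/ltW yx] := leP x y; first exact: H.
  by rewrite distrC (distrC x); apply: H.
rewrite !in_itv/= => /andP[ax xb] /andP[ay yb].
move: xy; rewrite le_eqVlt => /predU1P[->|xy]; first by rewrite !subrr normr0 mulr0.
have [c cab e] := MVTle ddg ax xy yb.
by rewrite distrC e normrM (distrC x) ler_wpM2r// le_M.
Qed.

(** The derivative bound is given inside the piece only, while the clamped inverse also takes the
    values a and b. It extends because g' is M-Lipschitz up to the endpoints: compare x with a point
    moved slightly towards the midpoint. *)
Let sd_closed x : x \in `[a, b] -> lam <= s * d x.
Proof.
move=> xab; apply/ler_addgt0Pr => e e0.
have M1 : 0 < M + 1 by rewrite ltr_wpDl.
pose t := Num.min 1 (e / (M + 1)).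
have t0 : 0 < t by rewrite lt_min ltr01 divr_gt0.
have t1 : t <= 1 by rewrite ge_min lexx.
have te : M * t <= e.
  apply: (@le_trans _ _ ((M + 1) * t)); first by rewrite ler_wpM2r ?(ltW t0)// lerDl.
  by rewrite mulrC -ler_pdivlMr// ge_min lexx orbT.
pose y := x + t * ((a + b) / 2 - x).
have [ax xb] : a <= x /\ x <= b by move: xab; rewrite in_itv => /andP.
have h := ab; have h1 := b1; have h0 := a0.
have yab : y \in `]a, b[.
  rewrite in_itv/= /y; apply/andP; split; nra.
have sdx : `|s * d x - s * d y| <= M * `|x - y|.
  rewrite -mulrBr normrM (_ : `|s| = 1); last by case: s1 => ->; rewrite ?normrN normr1.
  by rewrite mul1r dlip// ooW.
have : `|x - y| <= t.
  rewrite /y opprD addrA subrr add0r normrN normrM (gtr0_norm t0).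
  by rewrite -[leRHS]mulr1 ler_wpM2l ?(ltW t0)// ler_norml; apply/andP; split; lra.
move=> /(ler_wpM2l M_ge0) h2; have := sd yab; move: sdx; rewrite ler_distl => /andP[h3 _].
lra.
Qed.

Let G x := (s * d (ginv (clamp x)))^-1.

Let ginv_lip x y : `|ginv (clamp x) - ginv (clamp y)| <= lam^-1 * `|x - y|.
Proof.
have [z zab gz] := clamp_img x; have [t tab gt] := clamp_img y.
rewrite mulrC ler_pdivlMr ?(lt_trans _ lam1)// mulrC.
have -> : ginv (clamp x) = z by rewrite -gz ginvK.
have -> : ginv (clamp y) = t by rewrite -gt ginvK.
apply: le_trans (expand_abs zab tab) _; rewrite gz gt.
exact: clamp_lipschitz.
Qed.

Let ginv_ab x : ginv (clamp x) \in `[a, b].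
Proof. by have [z zab <-] := clamp_img x; rewrite ginvK. Qed.

Let lam_gt0 : 0 < lam. Proof. exact: lt_trans lam1. Qed.

Let Ginv_ge x : lam <= s * d (ginv (clamp x)).
Proof. exact: sd_closed. Qed.

Let G_gt0 x : 0 < G x.
Proof. by rewrite invr_gt0 (lt_le_trans lam_gt0). Qed.

Let G_le x : G x <= lam^-1.
Proof. by rewrite lef_pV2 ?posrE ?(lt_le_trans lam_gt0). Qed.

Let norm_s : `|s| = 1.
Proof. by case: s1 => ->; rewrite ?normrN normr1. Qed.

(** One factor 1/lam of M/lam^2 is the contraction of the inverse branch, the other comes from
    dividing by |g'| >= lam. *)
Let G_dist x y : G x <= G y * (1 + M / lam ^+ 2 * `|x - y|).
Proof.
set p := s * d (ginv (clamp x)); set q := s * d (ginv (clamp y)).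
have p0 : 0 < p := lt_le_trans lam_gt0 (Ginv_ge x).
have q0 : 0 < q := lt_le_trans lam_gt0 (Ginv_ge y).
have pq : `|p - q| <= M * (lam^-1 * `|x - y|).
  rewrite /p /q -mulrBr normrM norm_s mul1r.
  apply: le_trans (dlip (ginv_ab _) (ginv_ab _)) _.
  by rewrite ler_wpM2l.
rewrite /G -/p -/q -[X in X <= _]mul1r ler_pdivrMr//.
rewrite -[q^-1 * _ * p]mulrA mulrC ler_pdivlMr// mul1r mulrDl mul1r -lerBlDl.
apply: (@le_trans _ _ (M * (lam^-1 * `|x - y|))).
  by rewrite (le_trans _ pq)// distrC ler_norm.
rewrite (_ : _ * p = M * (lam^-1 * `|x - y|) * (p / lam)); last first.
  by field; rewrite gt_eqF.
apply: ler_peMr; last by rewrite ler_pdivlMr// mul1r Ginv_ge.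
by rewrite !mulr_ge0// invr_ge0 ltW.
Qed.

Let G_lip x y : `|G x - G y| <= M * `|x - y|.
Proof.
wlog h : x y / G y <= G x.
  move=> H; have [/H//|/ltW/H] := leP (G y) (G x).
  by rewrite distrC (distrC y).
rewrite ger0_norm ?subr_ge0// lerBlDl.
apply: le_trans (G_dist x y) _.
rewrite mulrDr mulr1 lerD2l mulrA ler_wpM2r//.
rewrite mulrA mulrAC -[leRHS]mul1r ler_wpM2r//.
rewrite ler_pdivrMr ?exprn_gt0// mul1r.
apply: (@le_trans _ _ lam^-1); first exact: G_le.
apply: (@le_trans _ _ 1); first by rewrite invf_le1// ltW.
by rewrite exprn_ege1// ltW.
Qed.

Let mG : measurable_fun (setT : set R) G.
Proof. exact: continuous_measurable_fun (lipschitz_continuous G_lip). Qed.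

Let mginv : measurable_fun (setT : set R) (ginv \o clamp).
Proof. exact: continuous_measurable_fun (lipschitz_continuous ginv_lip). Qed.

Definition piece_w : R -> R := G \_ `]L0, U0[.
Definition piece_inv : R -> R := (ginv \o clamp) \_ `]L0, U0[.

Let sLU x : (s * g a < s * x < s * g b) = (L0 < x < U0).
Proof.
have h := smono (lexx a) ab (lexx b).
case: s1 h => ->; rewrite ?mul1r ?mulN1r /L0 /U0 => h.
  by rewrite (min_l (ltW h)) (max_r (ltW h)).
by rewrite !ltrN2 andbC; rewrite ltrN2 in h; rewrite (min_r (ltW h)) (max_l (ltW h)).
Qed.

Let gLU y : a < y < b -> L0 < g y < U0.
Proof. by move=> yab; rewrite -sLU simage//; exists y. Qed.

Let T_g y : a < y < b -> T y = g y.
Proof. by move=> yab; rewrite Tg// in_itv. Qed.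

Let w_g y : a < y < b -> piece_w (g y) = `|derive1 T y|^-1.
Proof.
move=> yab; have yoo : y \in `]a, b[ by rewrite in_itv.
have h := gLU yab; have /andP[h1 h2] := h.
rewrite /piece_w patchE mem_set//= /G clampK ?(ltW h1) ?(ltW h2)//.
rewrite ginvK ?ooW// piece_derive1//.
have : 0 < s * d y by rewrite (lt_le_trans lam_gt0)// sd.
by move=> /gtr0_norm <-; rewrite normrM norm_s mul1r.
Qed.

Let inv_g y : a < y < b -> piece_inv (g y) = y.
Proof.
move=> yab; have yoo : y \in `]a, b[ by rewrite in_itv.
have h := gLU yab; have /andP[h1 h2] := h.
rewrite /piece_inv patchE mem_set//= clampK ?(ltW h1) ?(ltW h2)//.
by rewrite ginvK ?ooW.
Qed.

Let w_ge0 x : 0 <= piece_w x.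
Proof. by rewrite /piece_w patchE; case: ifPn => // _; exact: ltW. Qed.

Let supp_LU x : piece_w x != 0 -> exists2 y, a < y < b & g y = x.
Proof.
rewrite /piece_w patchE; case: ifPn; last by rewrite eqxx.
by rewrite inE/= in_itv/= -sLU => h _; apply/simage.
Qed.

Let supp x : piece_w x != 0 -> a < piece_inv x < b /\ T (piece_inv x) = x.
Proof.
by move=> /supp_LU[y yab <-]; rewrite inv_g// T_g.
Qed.

Let piece_inv01 x : piece_inv x \in `[0, 1].
Proof.
rewrite /piece_inv patchE; case: ifPn => _; last by rewrite in_itv/= lexx ler01.
have := ginv_ab x; rewrite !in_itv/= => /andP[h1 h2].
by rewrite (le_trans a0 h1) (le_trans h2).
Qed.

Let image l u : a <= l -> l < u -> u <= b ->
  exists p : R * R, p.1 < p.2 /\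
    forall x, p.1 < x < p.2 <-> exists2 y, l < y < u & T y = x.
Proof.
move=> al lu ub.
have ex x : (s * g l < s * x < s * g u) <-> exists2 y, l < y < u & T y = x.
  rewrite simage//; split=> -[y /andP[ly yu] <-]; exists y; rewrite ?ly ?yu//.
    by rewrite T_g// (le_lt_trans al ly) (lt_le_trans yu ub).
  by rewrite T_g// (le_lt_trans al ly) (lt_le_trans yu ub).
have h := smono al lu ub; move: ex h; case: s1 => ->.
  by move=> ex h; exists (g l, g u); split => /= [|x]; rewrite -?ex !mul1r// in h *.
move=> ex h; exists (g u, g l); split => /= [|x]; first by rewrite !mulN1r ltrN2 in h.
by rewrite -ex !mulN1r !ltrN2 andbC.
Qed.

Let contr y z : a < y < b -> a < z < b -> `|y - z| <= lam^-1 * `|T y - T z|.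
Proof.
move=> yab zab; rewrite ler_pdivlMl// !T_g//.
by apply: expand_abs; apply: ooW; rewrite in_itv.
Qed.

Let dist y z : a < y < b -> a < z < b ->
  piece_w (T y) <= piece_w (T z) * expR (M / lam ^+ 2 * `|T y - T z|).
Proof.
move=> yab zab; rewrite !T_g// /piece_w !patchE !mem_set/= ?in_itv/= ?gLU//.
apply: le_trans (G_dist _ _) _; apply: ler_wpM2l; first exact: ltW.
exact: expR_ge1Dx.
Qed.

Let mw : measurable_fun (setT : set R) piece_w.
Proof. by apply/(measurable_restrictT _ _).1 => //; exact: measurable_funTS. Qed.

Let minv : measurable_fun (setT : set R) piece_inv.
Proof. by apply/(measurable_restrictT _ _).1 => //; exact: measurable_funTS. Qed.

Hypothesis T01 : forall y, a < y < b -> 0 <= T y <= 1.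

(** The substitution x = g y leaves the integrand 1, as G (g y) = 1/|g' y| on the closed piece.
    Minimum and maximum cover both orientations. *)
Let G_subst c e : a <= c -> c < e -> e <= b ->
  (\int[@lebesgue_measure R]_(x in `[Num.min (g c) (g e), Num.max (g c) (g e)]) (G x)%:E
   = (e - c)%:E)%E.
Proof.
move=> ac ce eb.
have h := smono ac ce eb.
have ce_ab x : x \in `[c, e] -> x \in `[a, b].
  by rewrite !in_itv/= => /andP[cx xe]; rewrite (le_trans ac)// (le_trans xe).
have cG : continuous G by exact: lipschitz_continuous G_lip.
have cd x : x \in `[c, e] -> {for x, continuous d}.
  by move=> /ce_ab xab; exact: (cont_at (ddg xab)).
have cg x : x \in `[c, e] -> {for x, continuous g}.
  by move=> /ce_ab xab; exact: (cont_at (dg xab)).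
have cce : c \in `[c, e] by rewrite in_itv/= lexx ltW.
have ece : e \in `[c, e] by rewrite in_itv/= lexx ltW.
have cdo : {in `]c, e[, continuous d}.
  by move=> x xce; apply: cd; exact: subset_itv_oo_cc.
have dgo : derivable_oo_LRcontinuous g c e.
  split.
  - move=> x xce; have xab : x \in `[a, b] by apply: ce_ab; exact: subset_itv_oo_cc.
    by have [] := dg xab.
  - by apply: cvg_at_right_filter; exact: cg.
  - by apply: cvg_at_left_filter; exact: cg.
have dc : cvg (d x @[x --> c^'+]).
  by apply: (cvgP (d c)); apply: cvg_at_right_filter; exact: cd.
have de : cvg (d x @[x --> e^'-]).
  by apply: (cvgP (d e)); apply: cvg_at_left_filter; exact: cd.
have Gg x : x \in `[c, e] -> G (g x) = (s * d x)^-1.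
  move=> /ce_ab xab; rewrite /G clampK ?ginvK//.
  move: (xab); rewrite in_itv/= => /andP[ax xb].
  have : s * g a <= s * g x <= s * g b.
    have smle u v : a <= u -> u <= v -> v <= b -> s * g u <= s * g v.
      by move=> au; rewrite le_eqVlt => /predU1P[->//|uv] vb; rewrite ltW// smono.
    by rewrite !smle.
  have h2 := smono (lexx a) ab (lexx b).
  move: h2; rewrite /L0 /U0; case: s1 => ->; rewrite ?mul1r ?mulN1r.
    by move=> h2; rewrite (min_l (ltW h2)) (max_r (ltW h2)).
  by rewrite ltrN2 !lerN2 => h2; rewrite (min_r (ltW h2)) (max_l (ltW h2)) andbC.
have cst1 : (\int[@lebesgue_measure R]_(x in `[c, e]) 1%:E = (e - c)%:E)%E.
  rewrite integral_cst// mul1e /= lebesgue_measure_itv/= lte_fin ce.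
  by rewrite EFinB.
have mono x y : x \in `[c, e] -> y \in `[c, e] -> x < y -> s * g x < s * g y.
  move=> /ce_ab + /ce_ab; rewrite !in_itv/= => /andP[h1 h2] /andP[h3 h4] xy.
  exact: smono.
have sd0 x : x \in `[c, e] -> s * d x != 0.
  by move=> /ce_ab xab; rewrite gt_eqF// (lt_le_trans lam_gt0)// sd_closed.
rewrite -cst1; case: s1 h Gg mono sd0 => ->.
  rewrite !mul1r => h Gg mono sd0; rewrite (min_l (ltW h)) (max_r (ltW h)).
  rewrite (integration_by_substitution_increasing (ltW ce))//.
  - apply: eq_integral => x /[!inE]/= xce; rewrite fctE /= Gg// mul1r mulVf//.
    by rewrite -[d x]mul1r sd0.
  - by move=> x y xce yce xy; have := mono x y xce yce xy; rewrite !mul1r.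
  - exact: continuous_subspaceT.
rewrite !mulN1r ltrN2 => h Gg mono sd0; rewrite (min_r (ltW h)) (max_l (ltW h)).
rewrite (integration_by_substitution_decreasing (ltW ce))//.
- apply: eq_integral => x /[!inE]/= xce; rewrite !fctE /= Gg// mulN1r mulVf//.
  by rewrite -mulN1r sd0.
- by move=> x y xce yce xy; have := mono y x yce xce xy; rewrite !mulN1r ltrN2.
- exact: continuous_subspaceT.
Qed.

Let wpull_itv c e : a <= c -> c < e -> e <= b ->
  (wpull piece_w piece_inv `]c, e] = (e - c)%:E)%E.
Proof.
move=> ac ce eb; rewrite -G_subst//.
set al := Num.min (g c) (g e); set be := Num.max (g c) (g e).
have img x : (al < x < be) <-> exists2 y, c < y < e & g y = x.
  rewrite -simage//; have h := smono ac ce eb.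
  case: s1 h => ->; rewrite /al /be ?mul1r ?mulN1r => h.
    by rewrite (min_l (ltW h)) (max_r (ltW h)).
  rewrite ltrN2 in h; rewrite (min_r (ltW h)) (max_l (ltW h)).
  by rewrite !ltrN2 andbC.
have sub x : al < x < be -> x \in `[0, 1].
  move=> /img[y /andP[cy ye] <-].
  have yab : a < y < b by rewrite (le_lt_trans ac cy) (lt_le_trans ye eb).
  by rewrite -T_g// in_itv/= T01.
(* The point g e is removed: []c, e]] contains e, but g e is an endpoint of the open image interval,
   so the two integrands may differ there. *)
have m01 : measurable (`[0, 1]%classic `\ g e : set (measurableTypeR R)).
  by apply: measurableD.
have mGE (D : set R) : measurable_fun D (fun x => (G x)%:E).
  by apply/measurable_EFinP; exact: measurable_funTS.
have mGr (D : set R) : measurable D -> measurable_fun D ((fun x => (G x)%:E) \_ `]al, be[).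
  move=> mD; apply: measurable_funTS; apply/(measurable_restrictT _ _).1 => //.
rewrite /wpull -(integral_setD1 m01); last first.
  apply: emeasurable_funM; apply/measurable_EFinP; apply: measurable_funTS => //.
  apply: (measurableT_comp _ minv); exact: measurable_indic.
transitivity (\int[@lebesgue_measure R]_(x in `[0%R, 1%R] `\ g e) ((fun x => (G x)%:E) \_ `]al, be[) x)%E.
  apply: eq_integral => x /[!inE]/= -[x01 /eqP xge].
  have [w0|wx] := eqVneq (piece_w x) 0.
    rewrite w0 mul0e patchE; case: ifPn => // /[!inE]/= /[!in_itv]/= /img[y /andP[cy ye] e1].
    have yab : a < y < b by rewrite (le_lt_trans ac cy) (lt_le_trans ye eb).
    move: w0; rewrite -e1 /piece_w patchE mem_set/= ?in_itv/= ?gLU// => w0.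
    by have := G_gt0 (g y); rewrite w0 ltxx.
  have [y yab e1] := supp_LU wx; rewrite -e1 inv_g//.
  have -> : piece_w (g y) = G (g y).
    by rewrite /piece_w patchE mem_set/= ?in_itv/= ?gLU.
  have [h|h] := boolP (al < g y < be).
    have [z zce /sinj zy] := (img _).1 h.
    have yz : z = y.
      apply: zy; apply: ooW; rewrite in_itv//=.
      by move: zce => /andP[cz ze]; rewrite (le_lt_trans ac cz) (lt_le_trans ze eb).
    rewrite patchE mem_set/= ?in_itv//= indicE mem_set/= ?mule1//.
    by rewrite in_itv/= -yz; move: zce => /andP[-> /ltW].
  rewrite patchE memNset/= ?in_itv/=; last exact/negP.
  rewrite indicE memNset/= ?mule0// in_itv/= => /andP[cy ye].
  move: h => /negP; apply; apply/img; exists y => //; rewrite cy lt_neqAle ye andbT.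
  by apply/eqP => ye'; move/eqP: xge; apply; rewrite -e1 ye'.
rewrite integral_setD1//; last by apply: mGr.
rewrite -integral_mkcondr (_ : _ `&` _ = `]al, be[%classic); last first.
  by apply/seteqP; split => [x []//|x/=]; rewrite in_itv/= => xab; split => //; exact: sub.
exact/esym/integral_itv_bndoo.
Qed.

Lemma piece_inverse_branch :
  inverse_branch T a b lam (M / lam ^+ 2) piece_inv piece_w.
Proof.
split => //.
- by move=> y yab; rewrite T_g// w_g.
- by move=> y yab; rewrite T_g// inv_g.
- apply: integral_change_of_variables => //.
  by move=> x /supp[].
Qed.

End monotone_branch.

Lemma smooth_inverse_branch : (forall y, a < y < b -> 0 <= T y <= 1) ->
  exists sg w, inverse_branch T a b lam (M / lam ^+ 2) sg w.
Proof.
move=> T01; have [s s1 sd] := piece_sign.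
by exists piece_inv, (piece_w s); exact: piece_inverse_branch.
Qed.

End smooth_piece.

(** * Piecewise expanding maps and their transfer operators *)

Lemma measurable_comp01 (R : realType) (D : set R) (f sg : R -> R) :
  measurable_fun (`[0, 1]%classic : set R) f -> measurable_fun D sg ->
  (forall x, D x -> sg x \in `[0, 1]) -> measurable_fun D (fun x => f (sg x)).
Proof.
move=> mf ms s01; apply: (measurable_comp _ _ mf ms) => //.
by move=> _ [x Dx <-]; exact: s01.
Qed.

Lemma closure_itvoo_cc (R : realType) (a b x : R) : a < b -> x \in `[a, b] ->
  closure `]a, b[%classic x.
Proof.
move=> ab; rewrite in_itv/= => /andP[ax xb] B /nbhs_ballP[e /= e0 eB].
have [xa|xa] := leP b x; last first.
  pose t := Num.min (e / 2) ((b - x) / 2).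
  have t0 : 0 < t by rewrite lt_min !divr_gt0 ?subr_gt0.
  have te : t <= e / 2 by rewrite ge_min lexx.
  have tb : t <= (b - x) / 2 by rewrite ge_min lexx orbT.
  exists (x + t); split; first by rewrite /= in_itv/=; apply/andP; split; lra.
  apply: eB; rewrite /ball/= opprD addrA subrr add0r normrN gtr0_norm//; lra.
pose t := Num.min (e / 2) ((x - a) / 2).
have t0 : 0 < t by rewrite lt_min !divr_gt0 ?subr_gt0// (lt_le_trans ab).
have te : t <= e / 2 by rewrite ge_min lexx.
have tb : t <= (x - a) / 2 by rewrite ge_min lexx orbT.
exists (x - t); split; first by rewrite /= in_itv/=; apply/andP; split; lra.
apply: eB; rewrite /ball/= opprB addrC subrK gtr0_norm//; lra.
Qed.

Lemma itvoo_sub_cc (R : realType) (a b c d : R) :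
  (forall x, a < x < b -> c <= x <= d) -> a < b -> c <= a /\ b <= d.
Proof.
move=> H ab; split; rewrite leNgt; apply/negP => h.
  pose x := (a + Num.min b c) / 2.
  have [h1 h2] : Num.min b c <= b /\ Num.min b c <= c.
    by rewrite !ge_min !lexx orbT.
  have h3 : a < Num.min b c by rewrite lt_min ab.
  have /H/andP[] : a < x < b by rewrite /x; apply/andP; split; lra.
  by rewrite /x => h4 _; lra.
pose x := (b + Num.max a d) / 2.
have [h1 h2] : a <= Num.max a d /\ d <= Num.max a d.
  by rewrite !le_max !lexx orbT.
have h3 : Num.max a d < b by rewrite gt_max ab.
have /H/andP[] : a < x < b by rewrite /x; apply/andP; split; lra.
by rewrite /x => _ h4; lra.
Qed.

(** The interior of a piece is ]pe_lo, pe_hi[, also when the piece is empty or a single point. *)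
Definition pe_lo (R : realType) (T : pexp_map R) (i : 'I_(pe_card T)) : R :=
  inf [set` pe_part i].
Definition pe_hi (R : realType) (T : pexp_map R) (i : 'I_(pe_card T)) : R :=
  sup [set` pe_part i].

Section pexp_map_branches.
Context {R : realType} (T : pexp_map R).
Local Notation lo := (@pe_lo R T).
Local Notation hi := (@pe_hi R T).

Lemma pe_part_sub i x : [set` @pe_part R T i] x -> 0 <= x <= 1.
Proof.
move=> ix; have : `[0, 1]%classic x by rewrite -(pe_cover T); exists i.
by rewrite /= in_itv.
Qed.

Lemma pe_interiorE i : interior [set` @pe_part R T i] = `]lo i, hi i[%classic.
Proof.
rewrite interval_bounded_interior.
- by apply/seteqP; split => x /=; rewrite in_itv.
- exact: interval_is_interval.
- by exists 0 => x /pe_part_sub/andP[].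
- by exists 1 => x /pe_part_sub/andP[].
Qed.

Lemma pe_domP x : pe_dom T x <-> exists i, lo i < x < hi i.
Proof.
rewrite /pe_dom /pieces_interior; split.
  by move=> [i _]; rewrite pe_interiorE/= in_itv/= => h; exists i.
by move=> [i h]; exists i => //; rewrite pe_interiorE/= in_itv.
Qed.

Lemma pe_itv_sub i x : lo i < x < hi i -> 0 <= x <= 1.
Proof.
move=> h; apply: (@pe_part_sub i); apply: (@interior_subset _ [set` pe_part i]).
by rewrite pe_interiorE/= in_itv.
Qed.

Lemma pe_lo_ge0 i : lo i < hi i -> 0 <= lo i.
Proof. by move=> h; have [] := itvoo_sub_cc (@pe_itv_sub i) h. Qed.

Lemma pe_hi_le1 i : lo i < hi i -> hi i <= 1.
Proof. by move=> h; have [] := itvoo_sub_cc (@pe_itv_sub i) h. Qed.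

Lemma pe_itv_inj i j x : lo i < x < hi i -> lo j < x < hi j -> i = j.
Proof.
move=> xi xj; apply: (@pe_disjoint R T i j) => //; exists x.
by rewrite !pe_interiorE; split; rewrite /= in_itv.
Qed.

Lemma pe_dom_oo x : pe_dom T x -> 0 < x < 1.
Proof.
move=> /pe_domP[i /andP[h1 h2]].
have h : lo i < hi i by exact: lt_trans h2.
by rewrite (le_lt_trans (pe_lo_ge0 h) h1) (lt_le_trans h2 (pe_hi_le1 h)).
Qed.

Lemma pe_map01 x : 0 <= x <= 1 -> 0 <= T x <= 1.
Proof. by move=> h; have := @pe_range R T x; rewrite !in_itv/=; apply. Qed.

Lemma pe_exceptional_finite :
  finite_set (`[0, 1]%classic `\` \bigcup_i `]lo i, hi i[%classic).
Proof.
apply: (@sub_finite_set _ _ (\bigcup_(i in [set: 'I_(pe_card T)]) ([set lo i] `|` [set hi i]))); last first.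
  by apply: bigcup_finite => // i _; rewrite finite_setU; split; exact: finite_set1.
move=> x [x01 nx]; move: x01; rewrite -(pe_cover T) => -[i _ xi]; exists i => //.
have lx : lo i <= x by apply: ge_inf => //; exists 0 => y /pe_part_sub/andP[].
have xh : x <= hi i by apply: ub_le_sup => //; exists 1 => y /pe_part_sub/andP[].
move: lx xh; rewrite !le_eqVlt => /predU1P[<-|lx]; first by left.
move=> /predU1P[->|xh]; first by right.
by exfalso; apply: nx; exists i => //=; rewrite in_itv/= lx.
Qed.

Lemma pe_exceptional_null :
  (@lebesgue_measure R) (`[0, 1]%classic `\` \bigcup_i `]lo i, hi i[%classic) = 0%E.
Proof.
apply: countable_lebesgue_measure0; apply: finite_set_countable.
exact: pe_exceptional_finite.
Qed.

(** The map is continuous on each open piece, and the finitely many other points form a measurable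
    set whatever its values there. *)
Lemma measurable_pexp_map : measurable_fun (`[0, 1]%classic : set R) T.
Proof.
set U := \bigcup_i `]lo i, hi i[%classic.
move=> _ Y mY.
have -> : `[0, 1]%classic `&` T @^-1` Y =
    (\bigcup_i (`]lo i, hi i[%classic `&` T @^-1` Y)) `|`
    ((`[0, 1]%classic `\` U) `&` T @^-1` Y).
  apply/seteqP; split => [x [x01 Yx]|x [[i _ [xi Yx]]|[[x01 _] Yx]]]; last 2 first.
  - by split => //; move: xi; rewrite /= !in_itv/=; exact: pe_itv_sub.
  - by [].
  have [[i _ xi]|nU] := pselect (U x); last by right.
  by left; exists i.
apply: measurableU; last first.
  apply: countable_measurable => [y|]; first exact: measurable_set1.
  apply: finite_set_countable; apply: finite_setIl; exact: pe_exceptional_finite.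
apply: fin_bigcup_measurable => [|i _]; first exact: finite_finset.
suff : measurable_fun (`]lo i, hi i[%classic : set R) T by apply.
apply: open_continuous_measurable_fun; first exact: interval_open.
move=> x; rewrite inE => xi.
have [U' [g [_ AU gC2 Tg]]] := @pe_C2 R T i.
have xg : {for x, continuous g}.
  apply: differentiable_continuous; apply/derivable1_diffP.
  have [] // := gC2 x; apply: AU; apply: subset_closure.
  by apply: interior_subset; rewrite pe_interiorE.
have Tx : T x = g x by apply: Tg; rewrite pe_interiorE.
rewrite /continuous_at Tx; apply: cvg_trans xg; apply: near_eq_cvg.
near=> y; apply/esym/Tg; rewrite pe_interiorE.
by near: y; exact: near_in_itvoo.
Unshelve. all: by end_near. Qed.

Variables lam M : R.
Hypotheses (lam1 : 1 < lam)
  (dT : forall x, pe_dom T x -> lam <= `|derive1 T x|)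
  (ddT : forall x, pe_dom T x -> `|derive1n 2 T x| <= M).

Lemma pe_inverse_branches : exists sg w : 'I_(pe_card T) -> R -> R,
  forall i, inverse_branch T (lo i) (hi i) lam (M / lam ^+ 2) (sg i) (w i).
Proof.
suff /choice[p pP] : forall i, exists p : (R -> R) * (R -> R),
    inverse_branch T (lo i) (hi i) lam (M / lam ^+ 2) p.1 p.2.
  by exists (fun i => (p i).1), (fun i => (p i).2).
move=> i; have [h|h] := ltP (lo i) (hi i); last first.
  have nh y : lo i < y < hi i -> False.
    by move=> /andP[h1 h2]; have := lt_trans h1 h2; rewrite ltNge h.
  (* A piece without interior gets the zero weight. *)
  exists (fun=> 0, fun=> 0); split => //=.
  - by move=> x; rewrite in_itv/= lexx ler01.
  - by move=> x; rewrite eqxx.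
  - by move=> y /nh.
  - by move=> y /nh.
  - by move=> l u h1 h2 h3; have := le_lt_trans h1 (lt_le_trans h2 h3); rewrite ltNge h.
  - by move=> y z /nh.
  - move=> f _ _; rewrite integral0_eq; last by move=> x _; rewrite mul0e.
    by rewrite set_itv_ge ?integral_set0// bnd_simp -leNgt.
have [U [g [_ AU gC2 Tg]]] := @pe_C2 R T i.
have Tg' x : x \in `]lo i, hi i[ -> T x = g x.
  by move=> xi; apply: Tg; rewrite pe_interiorE.
have gU x : x \in `[lo i, hi i] -> U x.
  move=> xi; apply: AU; apply: closure_subset (closure_itvoo_cc h xi).
  by rewrite -pe_interiorE; exact: interior_subset.
have dom x : x \in `]lo i, hi i[ -> pe_dom T x.
  by rewrite in_itv/= => xi; apply/pe_domP; exists i.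
have [sg [w sw]] := smooth_inverse_branch (pe_lo_ge0 h) h (pe_hi_le1 h) lam1 gU gC2 Tg'
   (fun x xi => dT (dom x xi)) (fun x xi => ddT (dom x xi))
   (fun y yi => pe_map01 (pe_itv_sub yi)).
by exists (sg, w).
Qed.

Section branches.
Variables sg w : 'I_(pe_card T) -> R -> R.
Hypothesis B : forall i,
  inverse_branch T (lo i) (hi i) lam (M / lam ^+ 2) (sg i) (w i).

(** A point has at most one preimage in the interior of each piece, and one exactly when the weight
    of that piece is nonzero. Hence the sum over preimages is reindexed by pieces, at every x. *)
Lemma transferE (f : R -> R) x :
  transfer T f x = \sum_i w i x * f (sg i x).
Proof.
rewrite /transfer.
rewrite (_ : [set y | _] = (fun i => sg i x) @` [set` fun i => w i x != 0]); last first.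
  apply/seteqP; split => [y [/pe_domP[i yi] Tyx]|y [i /= wi <-]].
    exists i => /=; last by rewrite -Tyx (ib_sg (B i)).
    rewrite unfold_in /= -Tyx (ib_w (B i))// invr_eq0 normr_eq0 -normr_gt0.
    by rewrite (lt_le_trans _ (dT _)) ?(lt_trans _ lam1)//; apply/pe_domP; exists i.
  have [h1 h2] := ib_supp (B i) wi; split => //.
  by apply/pe_domP; exists i.
rewrite fsbig_image; last first.
  move=> i j /set_mem /= wi /set_mem /= wj e.
  have [h1 _] := ib_supp (B i) wi; have [h2 _] := ib_supp (B j) wj.
  by apply: (@pe_itv_inj i j (sg i x)) => //; rewrite e.
rewrite -(bigfs _ (r := index_enum 'I_(pe_card T)))//; last 2 first.
- exact: index_enum_uniq.
- by move=> i _; rewrite mem_index_enum.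
rewrite [RHS](bigID (fun i => w i x != 0))/= [X in _ + X]big1 ?addr0; last first.
  by move=> i /negPn/eqP ->; rewrite mul0r.
apply: eq_bigr => i wi; have [h1 h2] := ib_supp (B i) wi.
by rewrite -{3}h2 (ib_w (B i))// mulrC.
Qed.

(** Change of variables on each piece; the open pieces are disjoint and cover [0, 1] up to a finite
    set. *)
Lemma ge0_integral_transfer (f : R -> R) :
  measurable_fun (`[0, 1]%classic : set R) f ->
  (forall x, x \in `[0, 1] -> 0 <= f x) ->
  (\int[@lebesgue_measure R]_(x in `[0%R, 1%R]) (transfer T f x)%:E =
   \int[@lebesgue_measure R]_(x in `[0%R, 1%R]) (f x)%:E)%E.
Proof.
move=> mf f0.
have sub01 i : `]lo i, hi i[%classic `<=` `[0, 1]%classic.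
  by move=> x; rewrite /= !in_itv/= => /pe_itv_sub.
transitivity (\sum_i \int[@lebesgue_measure R]_(x in `[0%R, 1%R]) ((w i x)%:E * (f (sg i x))%:E))%E.
  rewrite -ge0_integral_sum//.
  - by apply: eq_integral => x _; rewrite transferE -sumEFin.
  - move=> i; apply: emeasurable_funM; apply/measurable_EFinP.
      by apply: measurable_funTS; exact: ib_mw (B i).
    apply: measurable_comp01 => //; last by move=> x _; exact: ib_sg01 (B i) x.
    by apply: measurable_funTS; exact: ib_msg (B i).
  - by move=> i x _; rewrite mule_ge0// lee_fin ?f0 ?(ib_w_ge0 (B i)) ?(ib_sg01 (B i)).
set N := `[0, 1]%classic `\` \bigcup_i `]lo i, hi i[%classic.
have mU : measurable (\bigcup_i `]lo i, hi i[%classic : set (measurableTypeR R)).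
  by apply: fin_bigcup_measurable => //; exact: finite_finset.
have mN : measurable (N : set (measurableTypeR R)) by apply: measurableD.
rewrite [RHS](ge0_negligible_integral mN)//; last 2 first.
- exact/measurable_EFinP.
- exact: pe_exceptional_null.
have UE : `[0, 1]%classic `\` N =
    \big[setU/set0]_(i <- index_enum 'I_(pe_card T)) `]lo i, hi i[%classic.
  rewrite -bigcup_seq; apply/seteqP; split => x.
    move=> [x01 /not_andP[//|/contrapT[i _ xi]]]; exists i => //=.
    exact: mem_index_enum.
  move=> [i _ xi]; split; first exact: sub01 xi.
  by case=> _; apply; exists i.
have sub : \big[setU/set0]_(i <- index_enum 'I_(pe_card T)) `]lo i, hi i[%classic
    `<=` `[0, 1]%classic by rewrite -UE; exact: subDsetl.
rewrite UE ge0_integral_bigsetU//=.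
- apply: eq_bigr => i _; rewrite (ib_int (B i) (f := EFin \o f))//.
    by apply/measurable_EFinP; apply: measurable_funS mf.
  by move=> x xi; rewrite lee_fin f0//; exact: (sub01 i x xi).
- exact: index_enum_uniq.
- move=> i j _ _ [x []]; rewrite /= !in_itv/=; exact: pe_itv_inj.
- by apply/measurable_EFinP; apply: measurable_funS mf.
- by move=> x /sub x01; rewrite lee_fin f0.
Qed.

Lemma bmeas_transfer (f : R -> R) : bmeas f -> bmeas (transfer T f).
Proof.
move=> [mf [C fC]].
apply: (@eq_bmeas _ (fun x => \sum_i w i x * f (sg i x))).
  by move=> x _; rewrite transferE.
apply: bmeas_sum => i; split.
  apply: measurable_funM.
    by apply: measurable_funTS; exact: ib_mw (B i).
  apply: measurable_comp01 => //; last by move=> x _; exact: ib_sg01 (B i) x.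
  by apply: measurable_funTS; exact: ib_msg (B i).
exists (lam^-1 * C) => x _; rewrite normrM ler_pM ?fC ?(ib_sg01 (B i))//.
rewrite ger0_norm ?(ib_w_ge0 (B i))//; have [->|wx] := eqVneq (w i x) 0.
  by rewrite invr_ge0 ltW// (lt_trans _ lam1).
have [h1 h2] := ib_supp (B i) wx.
rewrite -h2 (ib_w (B i))// lef_pV2 ?posrE ?(lt_trans _ lam1)//.
  by apply: dT; apply/pe_domP; exists i.
by rewrite (lt_le_trans _ (dT _)) ?(lt_trans _ lam1)//; apply/pe_domP; exists i.
Qed.

Lemma Ex_transfer (f : R -> R) : bmeas f -> Ex (transfer T f) = Ex f.
Proof.
move=> bf; have [mf [C fC]] := bf.
have ge0 (h : R -> R) : bmeas h -> (forall x, x \in `[0, 1] -> 0 <= h x) ->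
    Ex (transfer T h) = Ex h.
  move=> bh h0; apply: EFin_inj; rewrite -!Ex_int//; last exact: bmeas_transfer.
  by apply: ge0_integral_transfer => //; have [] := bh.
have bC : bmeas (fun=> C : R) := bmeas_cst C.
have C0 : 0 <= C.
  by apply: le_trans (normr_ge0 _) (fC 0 _); rewrite in_itv/= lexx ler01.
(* Adding the bound C of |f| reduces to nonnegative functions, since the operator is linear. *)
have -> : Ex f = Ex (fun x => f x + C) - Ex (fun=> C : R).
  by rewrite ExD// addrK.
rewrite -(ge0 (fun x => f x + C)); last 2 first.
- exact: bmeasD.
- by move=> x /fC; rewrite ler_norml -lerBlDr sub0r => /andP[].
rewrite -(ge0 (fun=> C))// -ExB; [|exact: bmeas_transfer (bmeasD bf bC)|exact: bmeas_transfer].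
apply: eq_Ex => x _; rewrite !transferE -sumrB; apply: eq_bigr => i _.
by rewrite -mulrBr addrK.
Qed.
End branches.

End pexp_map_branches.

(** * Inverse branches of the compositions *)

(** W is the supremum of w. The interval has length at most 1, so the distortion between any two of
    its points is at most e^dl. *)
Lemma sup_bounded_distortion (R : realType) (w : R -> R) (l u dl B : R) :
  l < u -> (forall x, l < x < u -> 0 <= x <= 1) -> 0 <= dl ->
  (forall x, l < x < u -> 0 <= w x <= B) ->
  (forall x y, l < x < u -> l < y < u -> w x <= w y * expR (dl * `|x - y|)) ->
  exists2 W, 0 <= W <= B &
    forall x, l < x < u -> w x <= W /\ W <= w x * expR dl.
Proof.
move=> lu lu01 dl0 wB wd.
pose S := [set w x | x in `]l, u[%classic].
pose m := (l + u) / 2.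
have mlu : l < m < u by rewrite /m; apply/andP; split; lra.
have Sm : S (w m) by exists m => //=; rewrite in_itv.
have Sub B' : (forall x, l < x < u -> w x <= B') -> sup S <= B'.
  move=> wB'; apply: sup_le_ub; first by exists (w m).
  by move=> _ [x + <-]; rewrite /= in_itv/=; exact: wB'.
have Sx x : l < x < u -> w x <= sup S.
  move=> xlu; apply: ub_le_sup; last by exists x => //=; rewrite in_itv.
  by exists B => _ [y + <-]; rewrite /= in_itv/= => /wB/andP[].
exists (sup S).
  apply/andP; split; last by apply: Sub => x /wB/andP[].
  by apply: le_trans (Sx m mlu); have /andP[] := wB m mlu.
move=> x xlu; split; first exact: Sx.
apply: Sub => y ylu; apply: le_trans (wd y x ylu xlu) _.
rewrite ler_wpM2l//; first by have /andP[] := wB x xlu.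
rewrite ler_expR -[leRHS]mulr1 ler_wpM2l// ler_norml.
by have /andP[? ?] := lu01 x xlu; have /andP[? ?] := lu01 y ylu; apply/andP; split; lra.
Qed.

Lemma sum_prod (R : realType) (I J : finType) (F : I * J -> R) :
  \sum_p F p = \sum_i \sum_j F (i, j).
Proof. by rewrite pair_big; apply: eq_bigr => -[]. Qed.

Lemma ae_meets_itv (R : realType) (Q : R -> Prop) (l u : R) :
  {ae @lebesgue_measure R, forall x, Q x} -> l < u ->
  exists2 x, l < x < u & Q x.
Proof.
move=> [N [mN N0 QN]] lu; apply: contrapT => nex.
have sub : `]l, u[%classic `<=` N.
  move=> x; rewrite /= in_itv/= => xlu; apply: QN => Qx; apply: nex; by exists x.
have := le_measure lebesgue_measure (mem_set (measurable_itv `]l, u[)) (mem_set mN) sub.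
rewrite [X in (_ <= X)%E]N0 /= lebesgue_measure_itv/= lte_fin lu -EFinB lee_fin.
by rewrite subr_le0 leNgt lu.
Qed.

(* An inverse branch [br_sg] of T_1^n over ]br_l, br_u[ and its weight
   [br_w] = 1 / |(T_1^n)' \o br_sg|, extended by 0 ([br_sg] is only required to
   map into [0, 1] elsewhere); [br_W] bounds the weight and is comparable to it. *)
Record branch (R : realType) := Branch {
  br_l : R; br_u : R; br_sg : R -> R; br_w : R -> R; br_W : R }.

(** The constants do not depend on n. Degenerate branches, with empty domain and weight bound 0, are
    kept so that the branches at time n+1 can be indexed by all pairs of a branch and a piece. *)
Record branch_ok (R : realType) (Z : nat -> R -> R) (lam Dl : R) (n : nat)
    (b : branch R) : Prop := BranchOk {
  bo_01 : forall x, br_l b < x < br_u b -> 0 <= x <= 1;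
  bo_W0 : 0 <= br_W b;
  bo_Wdeg : br_u b <= br_l b -> br_W b = 0;
  bo_w0 : forall x, 0 <= br_w b x;
  bo_pos : forall x, br_l b < x < br_u b -> 0 < br_w b x;
  bo_supp : forall x, br_w b x != 0 -> br_l b < x < br_u b;
  bo_mw : measurable_fun (setT : set R) (br_w b);
  bo_msg : measurable_fun (setT : set R) (br_sg b);
  bo_sg01 : forall x, br_sg b x \in `[0, 1];
  bo_Z : forall x, br_l b < x < br_u b -> Z n (br_sg b x) = x;
  bo_contr : forall x y j, br_l b < x < br_u b -> br_l b < y < br_u b ->
    (j <= n)%N -> `|Z j (br_sg b x) - Z j (br_sg b y)| <= lam ^- (n - j) * `|x - y|;
  bo_dist : forall x y, br_l b < x < br_u b -> br_l b < y < br_u b ->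
    br_w b x <= br_w b y * expR (Dl * `|x - y|);
  bo_W : forall x, br_l b < x < br_u b -> br_w b x <= br_W b;
  bo_W' : forall x, br_l b < x < br_u b -> br_W b <= br_w b x * expR Dl
}.

Lemma iter_map01 (R : realType) (T : nat -> pexp_map R) n x :
  0 <= x <= 1 -> 0 <= iter_map T n x <= 1.
Proof. by elim: n x => //= n IH x x01; apply: pe_map01; exact: IH. Qed.

Lemma measurable_iter_map (R : realType) (T : nat -> pexp_map R) n :
  measurable_fun (`[0, 1]%classic : set R) (iter_map T n).
Proof.
elim: n => [|n IH]; first exact: measurable_id.
apply: measurable_comp01 => //; first exact: measurable_pexp_map.
by move=> x; rewrite /= !in_itv/=; exact: iter_map01.
Qed.

(* Among disjoint intervals meeting ]l, u[, all but one have their left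
   endpoint in ]l, u[. *)
Lemma sum_meeting_pieces (R : realType) (T : pexp_map R) (l u c : R) :
  l < u -> 0 <= c ->
  \sum_(k < pe_card T | Num.max l (pe_lo k) < Num.min u (pe_hi k)) c <=
  c + \sum_(k < pe_card T | l < pe_lo k < u) c.
Proof.
move=> lu c0.
pose A := finset (fun k : 'I_(pe_card T) => Num.max l (pe_lo k) < Num.min u (pe_hi k)).
pose B := finset (fun k : 'I_(pe_card T) => l < pe_lo k < u).
have AB : (#|A :\: B| <= 1)%N.
  apply/card_le1_eqP => i j; rewrite !inE.
  rewrite !gt_max !lt_min => /andP[ni /andP[/andP[_ li] /andP[ui lhi]]].
  move=> /andP[nj /andP[/andP[_ lj] /andP[uj lhj]]].
  rewrite ui andbT -leNgt in ni; rewrite uj andbT -leNgt in nj.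
  (* Two pieces that meet ]l, u[ and start at or before l both contain the points just to the right
     of l. *)
  pose t := Num.min (pe_hi i) (pe_hi j).
  have lt : l < t by rewrite lt_min li lj.
  have [t1 t2] : t <= pe_hi i /\ t <= pe_hi j by rewrite !ge_min !lexx orbT.
  apply: (@pe_itv_inj _ _ j i ((l + t) / 2)); apply/andP; split; lra.
have -> : \sum_(k < pe_card T | Num.max l (pe_lo k) < Num.min u (pe_hi k)) c =
    \sum_(k in A) c by apply: eq_bigl => k; rewrite inE.
have -> : \sum_(k < pe_card T | l < pe_lo k < u) c = \sum_(k in B) c.
  by apply: eq_bigl => k; rewrite inE.
rewrite !sumr_const -mulrS ler_wpMn2l//.
rewrite -(cardsID B A) addnC -[(#|B|).+1]add1n leq_add// subset_leq_card//.
exact: subsetIr.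
Qed.

Section branches.
Context {R : realType} (T : nat -> pexp_map R) (lam M : R).
Hypotheses (lam1 : 1 < lam) (M0 : 0 <= M)
  (dT : forall n x, pe_dom (T n.+1) x -> lam <= `|derive1 (T n.+1) x|)
  (ddT : forall n x, pe_dom (T n.+1) x -> `|derive1n 2 (T n.+1) x| <= M).

Local Notation Z := (iter_map T).
Local Notation P := (iter_transfer T).
Let dl := M / lam ^+ 2.
(** The fixed point of D = D/lam + dl: one more map contracts the earlier distortion by 1/lam and
    contributes its own dl. *)
Definition distortion := dl / (1 - lam^-1).
Local Notation Dl := distortion.

Lemma bmeas_iter_transfer n f : bmeas f -> bmeas (P n f).
Proof.
move=> bf; elim: n => //= n IH.
have [sg [w B]] := pe_inverse_branches lam1 (@dT n) (@ddT n).
exact: (bmeas_transfer lam1 (@dT n) B).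
Qed.

Lemma Ex_iter_transfer n f : bmeas f -> Ex (P n f) = Ex f.
Proof.
move=> bf; elim: n => //= n IH.
have [sg [w B]] := pe_inverse_branches lam1 (@dT n) (@ddT n).
by rewrite (Ex_transfer lam1 (@dT n) B)//; exact: bmeas_iter_transfer.
Qed.

(** The formula is asked on ]0, 1[ only, since at time 0 the branch has the open domain ]0, 1[. This
    suffices to iterate, because preimages in the open pieces lie in ]0, 1[ again. *)
Definition branches_ok n (I : finType) (b : I -> branch R) : Prop :=
  (forall j, branch_ok Z lam Dl n (b j)) /\
  forall f x, 0 < x < 1 -> P n f x = \sum_j br_w (b j) x * f (br_sg (b j) x).

Let lam0 : 0 < lam. Proof. exact: lt_trans lam1. Qed.

Let dl0 : 0 <= dl.
Proof. by rewrite divr_ge0// exprn_ge0// ltW. Qed.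

Let Dl0 : 0 <= Dl.
Proof. by rewrite divr_ge0// subr_ge0 invf_le1// ltW. Qed.

Let DlE : lam^-1 * Dl + dl = Dl.
Proof.
have h : 1 - lam^-1 != 0 by rewrite gt_eqF// subr_gt0 invf_lt1.
have e : Dl * (1 - lam^-1) = dl by rewrite /Dl divfK.
by rewrite -e; ring.
Qed.

Lemma branches0 : exists2 b : unit -> branch R, branches_ok 0 b &
  \sum_j br_W (b j) = 1.
Proof.
exists (fun=> Branch 0 1 ((id : R -> R) \_ `]0%R, 1%R[) (\1_(`]0%R, 1%R[%classic) : R -> R) 1); last first.
  by rewrite (bigD1 tt)//= big1 ?addr0//; case.
have in1 x : 0 < x < 1 -> \1_(`]0%R, 1%R[%classic) x = 1 :> R.
  by move=> h; rewrite indicE mem_set//= in_itv.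
have sgE x : 0 < x < 1 -> ((id : R -> R) \_ `]0%R, 1%R[) x = x.
  by move=> h; rewrite patchE mem_set//= in_itv.
split; last first.
  by move=> f x x01; rewrite (bigD1 tt)//= big1 ?addr0 ?in1 ?sgE ?mul1r//; case.
move=> _; split => //=.
- by move=> x /andP[/ltW-> /ltW->].
- by rewrite leNgt ltr01.
- by move=> x h; rewrite in1.
- move=> x; rewrite indicE; case: (boolP (x \in _)) => [|_]; last by rewrite eqxx.
  by rewrite inE/= in_itv.
- by apply/(measurable_restrictT _ _).1.
- move=> x; rewrite patchE; case: ifPn => [|_]; last by rewrite in_itv/= lexx ler01.
  by rewrite inE/= !in_itv/= => /andP[/ltW-> /ltW->].
- by move=> x y j hx hy; rewrite leqn0 => /eqP -> /=; rewrite !sgE// subn0 expr0 invr1 mul1r.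
- by move=> x y hx hy; rewrite !in1// mul1r -expR0 ler_expR mulr_ge0.
- by move=> x hx; rewrite in1// mul1r -[leLHS]expR0 ler_expR.
Qed.

(** The new branch goes back through T_(n+1) by [sg] and then follows b. Its domain is the image
    under T_(n+1) of the part of the domain of b inside the piece. *)
Lemma branch_step n (b : branch R) (k : 'I_(pe_card (T n.+1))) sg w :
  branch_ok Z lam Dl n b ->
  inverse_branch (T n.+1) (pe_lo k) (pe_hi k) lam dl sg w ->
  exists b', [/\ branch_ok Z lam Dl n.+1 b',
    br_w b' = (fun x => br_w b (sg x) * w x),
    br_sg b' = (fun x => br_sg b (sg x)),
    br_W b' <= lam^-1 * br_W b &
    ~~ (Num.max (br_l b) (pe_lo k) < Num.min (br_u b) (pe_hi k)) ->
      br_W b' = 0].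
Proof.
move=> bo ib.
set l := Num.max (br_l b) (pe_lo k); set u := Num.min (br_u b) (pe_hi k).
pose w' x := br_w b (sg x) * w x; pose sg' x := br_sg b (sg x).
have luE y : l < y < u = (br_l b < y < br_u b) && (pe_lo k < y < pe_hi k).
  rewrite /l /u gt_max lt_min; move: (br_l b < y) (y < br_u b) (pe_lo k < y) (y < pe_hi k).
  by do 4 case.
have w'0 x : 0 <= w' x by rewrite mulr_ge0 ?(bo_w0 bo) ?(ib_w_ge0 ib).
have mw' : measurable_fun (setT : set R) w'.
  apply: measurable_funM; last exact: ib_mw ib.
  exact: (measurableT_comp (bo_mw bo) (ib_msg ib)).
have msg' : measurable_fun (setT : set R) sg'.
  exact: (measurableT_comp (bo_msg bo) (ib_msg ib)).
have supp x : w' x != 0 -> l < sg x < u /\ T n.+1 (sg x) = x.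
  rewrite mulf_eq0 negb_or => /andP[h1 h2]; have [h3 h4] := ib_supp ib h2.
  by rewrite luE h3 andbT (bo_supp bo h1).
have wsg y : l < y < u -> sg (T n.+1 y) = y.
  by rewrite luE => /andP[_ h]; rewrite (ib_sg ib).
have [lu|ul] := ltP l u; last first.
  exists (Branch 0 0 sg' w' 0).
  have nlu y : l < y < u -> False by move=> /andP[h1 h2]; have := lt_trans h1 h2; rewrite ltNge ul.
  have n0 (x : R) : 0 < x < 0 -> False by move=> /andP[h1 h2]; have := lt_trans h1 h2; rewrite ltxx.
  split => //=; last by rewrite mulr_ge0 ?(bo_W0 bo)// invr_ge0 ltW.
  split => //=; try by move=> x /n0.
  - by move=> x /supp[/nlu].
  - by move=> x; exact: bo_sg01 bo (sg x).
  - by move=> x y j /n0.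
  - by move=> x y /n0.
have [[L U] /= [LU img]] : exists p : R * R, p.1 < p.2 /\
      forall x, p.1 < x < p.2 <-> exists2 y, l < y < u & T n.+1 y = x.
  by apply: (ib_image ib) => //; rewrite ?le_max ?ge_min lexx orbT.
have y01 y : l < y < u -> 0 <= y <= 1.
  by rewrite luE => /andP[/(bo_01 bo)].
have LU01 x : L < x < U -> 0 <= x <= 1.
  by move=> /img[y /y01 h <-]; exact: pe_map01.
have lam_dT y : l < y < u -> lam <= `|derive1 (T n.+1) y|.
  by rewrite luE => /andP[_ h]; apply: dT; apply/pe_domP; exists k.
have wT y : l < y < u -> w (T n.+1 y) = `|derive1 (T n.+1) y|^-1.
  by rewrite luE => /andP[_ h]; exact: ib_w ib y h.
have w'pos x : L < x < U -> 0 < w' x.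
  move=> /img[y yl <-]; rewrite /w' wsg//; apply: mulr_gt0.
    by apply: (bo_pos bo); move: yl; rewrite luE => /andP[].
  by rewrite wT// invr_gt0 (lt_le_trans lam0)// lam_dT.
have w'B x : L < x < U -> 0 <= w' x <= lam^-1 * br_W b.
  move=> xLU; rewrite w'0/=; move/img: xLU => [y yl <-].
  rewrite /w' wsg// mulrC ler_pM ?(bo_w0 bo) ?(ib_w_ge0 ib)//.
    by rewrite wT// lef_pV2 ?posrE ?lam_dT// (lt_le_trans lam0)// lam_dT.
  by apply: (bo_W bo); move: yl; rewrite luE => /andP[].
have w'dist x z : L < x < U -> L < z < U -> w' x <= w' z * expR (Dl * `|x - z|).
  move=> /img[y yl <-] /img[t tl <-]; rewrite /w' !wsg//.
  have [/andP[yb yk] /andP[tb tk]] : (br_l b < y < br_u b) && (pe_lo k < y < pe_hi k)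
     /\ (br_l b < t < br_u b) && (pe_lo k < t < pe_hi k) by rewrite -!luE.
  have h1 := bo_dist bo yb tb; have h2 := ib_dist ib yk tk.
  have h3 := ib_contr ib yk tk.
  apply: le_trans (ler_pM _ _ h1 h2) _; rewrite ?(bo_w0 bo) ?(ib_w_ge0 ib)//.
  (* The exponents add up to Dl |y - t| + dl |T y - T t|, and the first distance is at most 1/lam
     times the second. *)
  rewrite mulrACA -expRD ler_wpM2l ?mulr_ge0 ?(bo_w0 bo) ?(ib_w_ge0 ib)//.
  rewrite ler_expR -[X in _ <= X * _]DlE [leRHS]mulrDl lerD2r.
  by rewrite [leRHS]mulrAC [leRHS]mulrC; apply: ler_wpM2l.
have [W /andP[W0 WB] W_] := sup_bounded_distortion LU LU01 Dl0 w'B w'dist.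
exists (Branch L U sg' w' W); split => //=.
split => //=.
- by rewrite leNgt LU.
- by move=> x /supp[h1 <-]; apply/img; exists (sg x).
- by move=> x; exact: bo_sg01 bo (sg x).
- move=> x /img[y yl <-]; rewrite /sg' wsg// (bo_Z bo)//.
  by move: yl; rewrite luE => /andP[].
- move=> x z j /img[y yl <-] /img[t tl <-]; rewrite /sg' !wsg//.
  have [/andP[yb yk] /andP[tb tk]] : (br_l b < y < br_u b) && (pe_lo k < y < pe_hi k)
     /\ (br_l b < t < br_u b) && (pe_lo k < t < pe_hi k) by rewrite -!luE.
  rewrite leq_eqVlt => /predU1P[->|]; first by rewrite subnn expr0 invr1 mul1r /= !(bo_Z bo).
  rewrite ltnS => jn; apply: le_trans (bo_contr bo yb tb jn) _.
  rewrite subSn// exprS invfM [lam^-1 * _]mulrC -mulrA; apply: ler_wpM2l.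
    by rewrite invr_ge0 exprn_ge0// ltW.
  exact: (ib_contr ib).
- by move=> x /W_[].
- by move=> x /W_[].
Qed.

(** The pieces of T_(n+1) cut the domain of a branch. Each descendant has at most 1/lam of its
    weight, and all but one are charged to the left endpoint of a piece inside the domain, whence
    the second sum. *)
Lemma branches_step n (I : finType) (b : I -> branch R) : branches_ok n b ->
  exists (J : finType) (b' : J -> branch R), branches_ok n.+1 b' /\
    \sum_j br_W (b' j) <= lam^-1 * (\sum_j br_W (b j) +
      \sum_(k < pe_card (T n.+1))
         \sum_(j | br_l (b j) < pe_lo k < br_u (b j)) br_W (b j)).
Proof.
move=> [bo PE].
have [sg [w B]] := pe_inverse_branches lam1 (@dT n) (@ddT n).
have /choice[b' b'P] : forall p : I * 'I_(pe_card (T n.+1)), exists b',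
  [/\ branch_ok Z lam Dl n.+1 b',
    br_w b' = (fun x => br_w (b p.1) (sg p.2 x) * w p.2 x),
    br_sg b' = (fun x => br_sg (b p.1) (sg p.2 x)),
    br_W b' <= lam^-1 * br_W (b p.1) &
    ~~ (Num.max (br_l (b p.1)) (pe_lo p.2) < Num.min (br_u (b p.1)) (pe_hi p.2)) ->
      br_W b' = 0].
  by move=> p; exact: branch_step (bo p.1) (B p.2).
exists (I * 'I_(pe_card (T n.+1)))%type, b'; split; first split.
- by move=> p; have [] := b'P p.
- move=> f x x01 /=; rewrite (transferE lam1 (@dT n) B).
  rewrite sum_prod exchange_big/=.
  apply: eq_bigr => k _.
  have [wk|wk] := eqVneq (w k x) 0.
    rewrite wk mul0r big1// => j _.
    by have [_ -> _ _ _] := b'P (j, k); rewrite /= wk mulr0 mul0r.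
  have [h1 h2] := ib_supp (B k) wk.
  rewrite PE; last by apply: (@pe_dom_oo _ (T n.+1)); apply/pe_domP; exists k.
  rewrite mulr_sumr; apply: eq_bigr => j _.
  by have [_ -> -> _ _] := b'P (j, k); rewrite /= mulrA [w k x * _]mulrC.
apply: (@le_trans _ _ (\sum_j lam^-1 * (br_W (b j) +
   \sum_(k < pe_card (T n.+1) | br_l (b j) < pe_lo k < br_u (b j)) br_W (b j)))); last first.
  rewrite -mulr_sumr big_split/= (exchange_big_dep xpredT)//=.
rewrite sum_prod.
apply: ler_sum => j _.
have [lu|ul] := ltP (br_l (b j)) (br_u (b j)); last first.
  rewrite (bo_Wdeg (bo j) ul) [X in _ * (_ + X)]big1// addr0 mulr0.
  apply: sumr_le0 => k _; have [_ _ _ + _] := b'P (j, k).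
  by rewrite /= (bo_Wdeg (bo j) ul) mulr0.
apply: (@le_trans _ _ (\sum_(k < pe_card (T n.+1) |
   Num.max (br_l (b j)) (pe_lo k) < Num.min (br_u (b j)) (pe_hi k)) lam^-1 * br_W (b j))).
  rewrite big_mkcond [leRHS]big_mkcond/=; apply: ler_sum => k _.
  have [_ _ _ h1 h2] := b'P (j, k).
  by case: ifPn h1 h2 => //= h _ ->.
rewrite mulrDr mulr_sumr; apply: sum_meeting_pieces => //.
by rewrite mulr_ge0 ?(bo_W0 (bo j))// invr_ge0 ltW.
Qed.

Lemma branches_exist n : exists (I : finType) (b : I -> branch R), branches_ok n b.
Proof.
elim: n => [|n [I [b bok]]]; first by have [b bok _] := branches0; exists unit, b.
by have [J [b' [b'ok _]]] := branches_step bok; exists J, b'.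
Qed.

(* By bounded distortion, the weights of the branches around [c] add up to at
   most a multiple of the density P_1^n 1 near [c]. *)
Lemma sum_branches_at n (I : finType) (b : I -> branch R) (B c : R) :
  branches_ok n b -> 0 <= B ->
  {ae @lebesgue_measure R, forall x, x \in `[0, 1] -> `|P n (cst 1) x| <= B} ->
  \sum_(j | br_l (b j) < c < br_u (b j)) br_W (b j) <= expR Dl * B.
Proof.
move=> [bo PE] B0 hB.
have [/existsP[i ci]|] := boolP [exists j, br_l (b j) < c < br_u (b j)]; last first.
  rewrite negb_exists => /forallP nj; rewrite big1 ?mulr_ge0 ?expR_ge0// => j cj.
  by have := nj j; rewrite cj.
(* The density bound holds almost everywhere and may fail at c; it is read at a nearby x that still
   lies in all the domains around c. *)
have nc : \forall x \near c, forall j, br_l (b j) < c < br_u (b j) ->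
    br_l (b j) < x < br_u (b j).
  refine (@filter_forall R I (fun j x => br_l (b j) < c < br_u (b j) ->
    br_l (b j) < x < br_u (b j)) (nbhs c) (nbhs_filter c) _) => j.
  have [cj|cj] := boolP (br_l (b j) < c < br_u (b j)).
    have : \forall x \near c, x \in `]br_l (b j), br_u (b j)[.
      by apply: near_in_itvoo; rewrite in_itv.
    by apply: filterS => x; rewrite in_itv.
  by apply: nearW => x.
have [e /= e0 he] := (nbhs_ballP _ _).1 nc.
have [x xe hx] : exists2 x, c - e < x < c + e & (x \in `[0, 1] -> `|P n (cst 1) x| <= B).
  by apply: (ae_meets_itv hB); lra.
have xin j : br_l (b j) < c < br_u (b j) -> br_l (b j) < x < br_u (b j).
  by apply: he; rewrite /ball/= ltr_distlC.
have lu01 := itvoo_sub_cc (bo_01 (bo i)).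
have x01 : 0 < x < 1.
  have /andP[h1 h2] := xin i ci; have [h3 h4] := lu01 (lt_trans h1 h2).
  by rewrite (le_lt_trans h3 h1) (lt_le_trans h2 h4).
have : `|P n (cst 1) x| <= B by apply: hx; rewrite in_itv/=; case/andP: x01 => /ltW-> /ltW->.
rewrite PE// => /(le_trans (ler_norm _)).
rewrite -(ler_pM2l (expR_gt0 Dl)); apply: le_trans.
rewrite mulr_sumr [leLHS]big_mkcond; apply: ler_sum => j _.
rewrite mulr1 mulrC; case: ifPn => [/xin xj|_].
  exact: bo_W' (bo j) _ xj.
by rewrite mulr_ge0 ?expR_ge0 ?(bo_w0 (bo j)).
Qed.

(** The sums satisfy S' <= (S + Q)/lam, where Q counts at most N endpoints of cost e^Dl B each. S =
    1 + Q/(lam - 1) is preserved for every lam > 1; the 1 is the sum at time 0. *)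
Lemma branches_bounded (N : nat) (B : R) : 0 <= B ->
  (forall n, (pe_card (T n.+1) <= N)%N) ->
  (forall n, {ae @lebesgue_measure R, forall x, x \in `[0, 1] ->
     `|P n (cst 1) x| <= B}) ->
  exists2 S : R, 1 <= S & forall n, exists (I : finType) (b : I -> branch R),
    branches_ok n b /\ \sum_j br_W (b j) <= S.
Proof.
move=> B0 hN hB.
pose Q := N%:R * (expR Dl * B).
have Q0 : 0 <= Q by rewrite mulr_ge0 ?ler0n// mulr_ge0 ?expR_ge0.
pose S := 1 + Q / (lam - 1).
have l1 : 0 < lam - 1 by rewrite subr_gt0.
have S1 : 1 <= S by rewrite lerDl divr_ge0// ltW.
exists S => //.
elim=> [|n [I [b [bok bS]]]].
  by have [b bok bE] := branches0; exists unit, b; split; rewrite ?bE.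
have [J [b' [b'ok b'S]]] := branches_step bok.
exists J, b'; split => //; apply: le_trans b'S _.
rewrite ler_pdivrMl//.
have : \sum_(k < pe_card (T n.+1))
         \sum_(j | br_l (b j) < pe_lo k < br_u (b j)) br_W (b j) <= Q.
  apply: (@le_trans _ _ (\sum_(k < pe_card (T n.+1)) (expR Dl * B))).
    by apply: ler_sum => k _; exact: (sum_branches_at _ bok).
  rewrite sumr_const card_ord -mulr_natl ler_wpM2r ?mulr_ge0 ?expR_ge0//.
  by rewrite ler_nat.
have SE : lam * S = S + (lam - 1) + Q.
  rewrite /S; field; exact: lt0r_neq0.
by lra.
Qed.

End branches.

(** * BV bounds for iterated transfer operators *)

Lemma ae_oo01 (R : realType) :
  {ae @lebesgue_measure R, forall x : R, x \in `[0, 1] -> 0 < x < 1}.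
Proof.
exists [set 0; 1]; split.
- by apply: measurableU; exact: measurable_set1.
- apply: countable_lebesgue_measure0; apply: finite_set_countable.
  by rewrite finite_setU; split; exact: finite_set1.
- move=> x /= /not_implyP[]; rewrite in_itv/= !le_eqVlt => /andP[].
  move=> /predU1P[<-|x0]; first by left.
  by move=> /predU1P[->|x1]; [right|rewrite x0 x1].
Qed.

Lemma L1norm_Ex (R : realType) (f : R -> R) : bmeas f ->
  L1norm f = (Ex (fun x => `|f x|))%:E.
Proof.
move=> [mf [B fB]]; rewrite -Ex_int//; split.
  exact: measurableT_comp.
by exists B => x x01; rewrite normr_id fB.
Qed.

Lemma bmeas_norm (R : realType) (f : R -> R) : bmeas f -> bmeas (fun x => `|f x|).
Proof.
move=> [mf [B fB]]; split; first exact: measurableT_comp.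
by exists B => x x01; rewrite normr_id fB.
Qed.

Section bounded_variation.
Context {R : realType} (T : nat -> pexp_map R) (lam M : R).
Hypotheses (lam1 : 1 < lam) (M0 : 0 <= M)
  (dT : forall n x, pe_dom (T n.+1) x -> lam <= `|derive1 (T n.+1) x|)
  (ddT : forall n x, pe_dom (T n.+1) x -> `|derive1n 2 (T n.+1) x| <= M).

Local Notation Z := (iter_map T).
Local Notation P := (iter_transfer T).
Local Notation Dl := (distortion lam M).

Let Dl0 : 0 <= Dl.
Proof.
have l0 : 0 < lam := lt_trans ltr01 lam1.
by rewrite !divr_ge0 ?subr_ge0 ?invf_le1 ?exprn_ge0// ltW.
Qed.

Section one_branch.
Variables (n : nat) (b : branch R) (f : R -> R) (B : R) (a : nat -> R).
Hypotheses (bo : branch_ok Z lam Dl n b)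
  (fB : forall x, x \in `[0, 1] -> `|f x| <= B)
  (a0 : forall j, 0 <= a j)
  (fa : forall x y, x \in `[0, 1] -> y \in `[0, 1] ->
     `|f x - f y| <= \sum_(j < n.+1) a j * `|Z j x - Z j y|).
Let A := \sum_(j < n.+1) a j * lam ^- (n - j).
Let g x := br_w b x * f (br_sg b x).
(** The slope accounts for the oscillation inside the domain (A from f, Dl B from the weight), the
    two jumps for the ends of the domain. The strict and the large inequality match the openness of
    the domain: the function vanishes at both ends. *)
Definition branch_majorant x : R := br_W b * (A + Dl * B) * x +
  br_W b * B * ((br_l b < x)%R%:R + (br_u b <= x)%R%:R).

Let B0 : 0 <= B.
Proof.
by apply: le_trans (fB (x := 0) _); rewrite ?normr_ge0// in_itv/= lexx ler01.
Qed.

Let A0 : 0 <= A.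
Proof.
apply: sumr_ge0 => j _; rewrite mulr_ge0// invr_ge0 exprn_ge0// ltW//.
exact: lt_trans lam1.
Qed.

Let w_lip x y : br_l b < x < br_u b -> br_l b < y < br_u b ->
  `|br_w b x - br_w b y| <= br_W b * (Dl * `|x - y|).
Proof.
wlog h : x y / br_w b y <= br_w b x.
  move=> H xb yb; have [|/ltW] := leP (br_w b y) (br_w b x); first by move/H; apply.
  by move=> h; rewrite distrC (distrC x); apply: H.
move=> xb yb; rewrite ger0_norm ?subr_ge0//.
set t := Dl * `|x - y|.
have t0 : 0 <= t by rewrite mulr_ge0.
have h1 : br_w b x * expR (- t) <= br_w b y.
  by rewrite expRN ler_pdivrMr ?expR_gt0//; exact: bo_dist bo _ _ xb yb.
have h2 : br_w b x * (1 - t) <= br_w b x * expR (- t).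
  by apply: ler_wpM2l; [exact: bo_w0 bo x|exact: expR_ge1Dx].
have h3 : br_w b x * t <= br_W b * t by apply: ler_wpM2r => //; exact: bo_W bo _ xb.
by rewrite mulrBr mulr1 in h2; lra.
Qed.

Lemma branch_majorantP x y : 0 <= x -> x <= y -> y <= 1 ->
  `|g y - g x| <= branch_majorant y - branch_majorant x.
Proof.
move=> x0 xy y1.
have [W0 wl] := (bo_W0 bo, w_lip).
have WB : 0 <= br_W b * B by rewrite mulr_ge0.
have LW : 0 <= br_W b * (A + Dl * B) by rewrite mulr_ge0// addr_ge0// mulr_ge0.
have Lxy : br_W b * (A + Dl * B) * x <= br_W b * (A + Dl * B) * y by rewrite ler_wpM2l.
have gout z : ~~ (br_l b < z < br_u b) -> g z = 0.
  by rewrite /g; have [->|/(bo_supp bo)->//] := eqVneq (br_w b z) 0; rewrite mul0r.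
have gW z : br_l b < z < br_u b -> `|g z| <= br_W b * B.
  move=> zb; rewrite normrM ler_pM ?fB ?(bo_sg01 bo)//.
  by rewrite ger0_norm ?(bo_w0 bo)// (bo_W bo).
have mono1 : (br_l b < x)%R%:R <= (br_l b < y)%R%:R :> R.
  by rewrite ler_nat; case: (ltP (br_l b) x) => // /lt_le_trans/(_ xy) ->.
have mono2 : (br_u b <= x)%R%:R <= (br_u b <= y)%R%:R :> R.
  by rewrite ler_nat; case: (leP (br_u b) x) => // /le_trans/(_ xy) ->.
rewrite /branch_majorant.
(* If x and y are both in the domain, the slope suffices; if only one is, the jump at the endpoint
   between them already covers its value. *)
have [xb|xb] := boolP (br_l b < x < br_u b); have [yb|yb] := boolP (br_l b < y < br_u b).
- have : `|g y - g x| <= br_W b * (A + Dl * B) * (y - x).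
    have -> : g y - g x = br_w b y * (f (br_sg b y) - f (br_sg b x)) +
        (br_w b y - br_w b x) * f (br_sg b x) by rewrite /g; ring.
    apply: le_trans (ler_normD _ _) _; rewrite !normrM.
    have -> : br_W b * (A + Dl * B) * (y - x) =
      br_W b * (A * (y - x)) + br_W b * (Dl * (y - x)) * B by ring.
    have yx : `|y - x| = y - x by rewrite ger0_norm ?subr_ge0.
    apply: lerD; apply: ler_pM => //; last 2 first.
    - by rewrite -yx; exact: wl.
    - exact: fB (bo_sg01 bo x).
    - by rewrite ger0_norm ?(bo_w0 bo)// (bo_W bo).
    apply: le_trans (fa (bo_sg01 bo y) (bo_sg01 bo x)) _.
    rewrite /A mulr_suml; apply: ler_sum => j _; rewrite -mulrA ler_wpM2l//.
    by rewrite -yx; apply: (bo_contr bo yb xb); rewrite -ltnS.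
  move=> h; have := ler_wpM2l WB mono1; have := ler_wpM2l WB mono2; lra.
- rewrite (gout y)// sub0r normrN.
  have -> : (br_u b <= y) = true.
    move: yb xb => + /andP[lx xu]; rewrite (lt_le_trans lx xy)/= -leNgt.
    by [].
  have /andP[lx xu] := xb; rewrite lx (lt_le_trans lx xy) [br_u b <= x]leNgt xu /=.
  by have := gW x xb; lra.
- rewrite (gout x)// subr0.
  have -> : (br_l b < x) = false.
    apply/negbTE; apply: contra xb => lx; rewrite lx (le_lt_trans xy)//.
    by case/andP: yb.
  have /andP[ly yu] := yb; rewrite ly !leNgt yu (le_lt_trans xy yu) /=.
  by have := gW y yb; lra.
- rewrite !gout// subr0 normr0.
  have := ler_wpM2l WB mono1; have := ler_wpM2l WB mono2; lra.
Qed.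

Lemma branch_majorant_le :
  branch_majorant 1 - branch_majorant 0 <= br_W b * (A + (2 + Dl) * B).
Proof.
have W0 := bo_W0 bo.
have WB : 0 <= br_W b * B by rewrite mulr_ge0.
have h (c d e k : bool) : (c%:R + d%:R) - (e%:R + k%:R) <= 2 :> R.
  by case: c; case: d; case: e; case: k => /=; lra.
have := ler_wpM2l WB (h (br_l b < 1) (br_u b <= 1) (br_l b < 0) (br_u b <= 0)).
by rewrite /branch_majorant; lra.
Qed.

End one_branch.

Section several_branches.
Variables (n : nat) (I : finType) (b : I -> branch R) (S B : R) (f : R -> R)
  (a : nat -> R).
Hypotheses (bok : branches_ok T lam M n b) (bS : \sum_j br_W (b j) <= S)
  (bf : bmeas f)
  (fB : forall x, x \in `[0, 1] -> `|f x| <= B)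
  (a0 : forall j, 0 <= a j)
  (fa : forall x y, x \in `[0, 1] -> y \in `[0, 1] ->
     `|f x - f y| <= \sum_(j < n.+1) a j * `|Z j x - Z j y|).
Let A := \sum_(j < n.+1) a j * lam ^- (n - j).

Let B0 : 0 <= B.
Proof.
by apply: le_trans (fB (x := 0) _); rewrite ?normr_ge0// in_itv/= lexx ler01.
Qed.

Let A0 : 0 <= A.
Proof.
apply: sumr_ge0 => j _; rewrite mulr_ge0// invr_ge0 exprn_ge0// ltW//.
exact: lt_trans lam1.
Qed.

Lemma iter_transfer_variation_le :
  (Defs.variation (P n f) <= (S * (A + (2 + Dl) * B))%:E)%E.
Proof.
have [bo PE] := bok.
pose G x := \sum_j branch_majorant n (b j) B a x.
apply: (@le_trans _ _ (G 1 - G 0)%:E).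
  apply: (@variation_le_mono _ _ (fun x => \sum_j br_w (b j) x * f (br_sg (b j) x))).
    by apply: filterS (@ae_oo01 R) => x h x01; rewrite PE ?h.
  move=> x y x0 xy y1; rewrite -!sumrB; apply: le_trans (ler_norm_sum _ _ _) _.
  by apply: ler_sum => j _; apply: branch_majorantP.
rewrite lee_fin -sumrB; apply: (@le_trans _ _ (\sum_j br_W (b j) * (A + (2 + Dl) * B))).
  by apply: ler_sum => j _; apply: (branch_majorant_le (f := f)).
by rewrite -mulr_suml ler_wpM2r// addr_ge0// mulr_ge0// addr_ge0.
Qed.

Lemma iter_transfer_norm_le x : 0 < x < 1 -> `|P n f x| <= S * B.
Proof.
move=> x01; have [bo PE] := bok; rewrite PE//.
apply: le_trans (ler_norm_sum _ _ _) _.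
apply: (@le_trans _ _ (\sum_j br_W (b j) * B)); last by rewrite -mulr_suml ler_wpM2r.
apply: ler_sum => j _; rewrite normrM ler_pM ?fB ?(bo_sg01 (bo j))//.
rewrite ger0_norm ?(bo_w0 (bo j))//.
have [->|/(bo_supp (bo j))] := eqVneq (br_w (b j) x) 0; first exact: bo_W0 (bo j).
exact: bo_W (bo j) x.
Qed.

Lemma iter_transfer_L1norm_le : (L1norm (P n f) <= (S * B)%:E)%E.
Proof.
have bP : bmeas (P n f) by exact: (bmeas_iter_transfer lam1 dT ddT).
rewrite L1norm_Ex// lee_fin -[leRHS]Ex_cst.
apply: le_Ex; [exact: bmeas_norm|exact: bmeas_cst|].
by apply: filterS (@ae_oo01 R) => x h /h; exact: iter_transfer_norm_le.
Qed.

(** The 3 is two jumps per branch plus one for the L1 norm. *)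
Lemma iter_transfer_BVnorm_le :
  (BVnorm (P n f) <= (S * (A + (3 + Dl) * B))%:E)%E.
Proof.
apply: le_trans (leeD iter_transfer_variation_le iter_transfer_L1norm_le) _.
by rewrite -EFinD lee_fin; apply/eqP/eqP; lra.
Qed.

Lemma iter_transfer_BV : BV (P n f).
Proof.
split; first by apply: bmeas_integrable; exact: (bmeas_iter_transfer lam1 dT ddT).
exact: le_lt_trans iter_transfer_variation_le (ltry _).
Qed.

End several_branches.

Lemma BV_iter_transfer1 n : BV (P n (cst 1)).
Proof.
have [I [b bok]] := branches_exist lam1 M0 dT ddT n.
apply: (iter_transfer_BV bok (lexx _) (bmeas_cst 1) (B := 1) (a := fun=> 0)) => //.
- by move=> x _; rewrite normr1.
- by move=> x y _ _; rewrite subrr normr0 sumr_ge0// => j _; rewrite mul0r.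
Qed.

Lemma L1norm_iter_transfer1 n : L1norm (P n (cst 1)) = 1%E.
Proof.
have [I [b [bo PE]]] := branches_exist lam1 M0 dT ddT n.
have b1 : bmeas (cst 1 : R -> R) := bmeas_cst 1.
have bP : bmeas (P n (cst 1)) by exact: (bmeas_iter_transfer lam1 dT ddT).
rewrite L1norm_Ex// -[in RHS](Ex_cst (1 : R)) -(Ex_iter_transfer lam1 dT ddT n b1).
congr EFin; apply/eqP; rewrite eq_le; apply/andP; split; apply: le_Ex => //;
  try exact: bmeas_norm; apply: filterS (@ae_oo01 R) => x h /h x01.
  rewrite ger0_norm// PE//; apply: sumr_ge0 => j _.
  by rewrite mulr1; exact: bo_w0 (bo j) x.
exact: ler_norm.
Qed.

Lemma iter_transfer_shift n r f :
  P (n + r) f = iter_transfer (fun k => T (n + k)%N) r (P n f).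
Proof. by elim: r => [|r IH]; rewrite ?addn0// addnS /= IH addnS. Qed.

(** As P_1^n 1 has L1 norm 1, r further maps take a BV norm v to at most rho v + Cr, which preserves
    v <= B. The first steps cost a factor m1 >= 1 each. *)
Lemma cond_D_density_bound (C : set (pexp_map R)) (r : nat) :
  (1 <= r)%N -> cond_D C r -> (forall n, C (T n.+1)) ->
  exists2 B : R, 0 <= B & forall n,
    {ae @lebesgue_measure R, forall x, x \in `[0, 1] -> `|P n (cst 1) x| <= B}.
Proof.
move=> r1 [rho [m [Cr [/andP[rho0 rho1] m0 Cr0 hm hr]]]] CT.
pose m1 := Num.max 1 m.
have m1_ge1 : 1 <= m1 by rewrite le_max lexx.
pose B := m1 ^+ r + Cr / (1 - rho).
have rho10 : 0 < 1 - rho by rewrite subr_gt0.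
have m1r : 0 <= m1 ^+ r by rewrite exprn_ge0// (le_trans _ m1_ge1).
have Crr : 0 <= Cr / (1 - rho) by rewrite divr_ge0// ltW.
have B0 : 0 <= B by rewrite addr_ge0.
have small n : (BVnorm (P n (cst 1%R)) <= (m1 ^+ n)%:E)%E.
  elim: n => [|n IH].
    rewrite expr0 /BVnorm L1norm_iter_transfer1 -[leRHS]add0e leeD2r//.
    have := @variation_le_mono R (cst 1) (cst 1) (cst 0) (aeW _ (fun _ _ => erefl)).
    by rewrite subrr; apply => x y _ _ _; rewrite !subrr normr0.
  apply: le_trans (hm _ _ (CT n) (BV_iter_transfer1 n)) _.
  rewrite exprS EFinM; apply: (@le_trans _ _ (m%:E * (m1 ^+ n)%:E)%E).
    by apply: lee_wpmul2l => //; rewrite lee_fin ltW.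
  rewrite -!EFinM lee_fin; apply: ler_wpM2r; last by rewrite /m1 le_max lexx orbT.
  by rewrite exprn_ge0// (le_trans _ m1_ge1).
have bound n : (BVnorm (P n (cst 1%R)) <= B%:E)%E.
  elim/ltn_ind: n => n IH; have [nr|rn] := ltnP n r.
    apply: le_trans (small n) _; rewrite lee_fin.
    apply: (@le_trans _ _ (m1 ^+ r)); last by rewrite lerDl.
    by rewrite ler_weXn2l// ltnW.
  have nE : n = (n - r + r)%N by rewrite subnK.
  rewrite nE iter_transfer_shift.
  have CT' k : (1 <= k <= r)%N -> C (T (n - r + k)%N).
    by case: k => // k _; rewrite addnS; exact: CT.
  apply: le_trans (hr _ _ CT' (BV_iter_transfer1 _)) _.
  rewrite L1norm_iter_transfer1 mule1.
  apply: (@le_trans _ _ (rho%:E * B%:E + Cr%:E)%E).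
    apply: leeD2r; apply: lee_wpmul2l; first by rewrite lee_fin ltW.
    by apply: IH; rewrite ltn_subrL r1 (leq_trans r1 rn).
  rewrite -EFinM -EFinD lee_fin.
  have [q e ->] : exists2 q, q * (1 - rho) = Cr & B = m1 ^+ r + q.
    by exists (Cr / (1 - rho)); rewrite ?divfK// gt_eqF.
  have : 0 <= m1 ^+ r * (1 - rho) by rewrite mulr_ge0// ltW.
  by rewrite -e; lra.
exists B => // n; apply: ae_le_BVnorm => //.
by have [] := bmeas_iter_transfer lam1 dT ddT n (bmeas_cst 1).
Qed.

End bounded_variation.

(** * Separately Lipschitz functions of a sequence *)

Definition in_cube (R : realType) (u : nat -> R) : Prop := forall j, 0 <= u j <= 1.

Definition mix (R : realType) (p : nat) (u v : nat -> R) : nat -> R :=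
  fun j => if (j < p)%N then u j else v j.

(** K reads infinite sequences, so that whole orbits and tails can be substituted without index
    bounds; [sl_ext] says that only n coordinates count. *)
Record sep_lip (R : realType) (n : nat) (K : (nat -> R) -> R) (L : nat -> R)
    : Prop := SepLip {
  sl_ge0 : forall k, 0 <= L k;
  sl_lip : forall k u v, (k < n)%N -> in_cube u -> in_cube v ->
    (forall j, j != k -> u j = v j) -> `|K u - K v| <= L k * `|u k - v k|;
  sl_ext : forall u v, (forall j, (j < n)%N -> u j = v j) -> K u = K v
}.

Lemma in_cube_mix (R : realType) p (u v : nat -> R) :
  in_cube u -> in_cube v -> in_cube (mix p u v).
Proof. by move=> uc vc j; rewrite /mix; case: ifP. Qed.

Lemma grid_dense (R : realType) (u : nat -> R) (n : nat) (e : R) :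
  in_cube u -> 0 < e -> exists s : seq rat, forall k, (k < n)%N ->
    `|u k - Num.max 0 (Num.min 1 (ratr (nth 0%Q s k)))| <= e.
Proof.
move=> uc e0.
have /choice[q hq] : forall k, exists q : rat, u k - e < ratr q < u k + e.
  move=> k; have [|q] := @rat_in_itvoo R (u k - e) (u k + e); first by lra.
  by rewrite in_itv/=; exists q.
exists (mkseq q n) => k kn; rewrite nth_mkseq//.
have uk : Num.max 0 (Num.min 1 (u k)) = u k.
  by have /andP[h1 h2] := uc k; rewrite (min_r h2) (max_r h1).
rewrite -{1}uk; apply: le_trans (clamp_lipschitz _ _ _ _) _.
by rewrite ltW// distrC ltr_norml; have /andP[h1 h2] := hq k; apply/andP; split; lra.
Qed.

(** A countable dense set of points of the cube. It serves both for measurability and for a null set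
    common to all tails. *)
Definition grid (R : realType) (s : seq rat) : nat -> R :=
  fun k => Num.max 0 (Num.min 1 (ratr (nth 0%Q s k))).

Lemma in_cube_grid (R : realType) (s : seq rat) : in_cube (grid R s).
Proof. by move=> k; rewrite /grid le_max lexx/= ge_max ler01/= ge_min lexx. Qed.

Section separately_lipschitz.
Context {R : realType} (n : nat) (K : (nat -> R) -> R) (L : nat -> R).
Hypothesis KL : sep_lip n K L.

Lemma sl_mix p u v : (p < n)%N -> in_cube u -> in_cube v ->
  `|K (mix p.+1 u v) - K (mix p u v)| <= L p * `|u p - v p|.
Proof.
move=> pn uc vc.
apply: le_trans (sl_lip KL pn (in_cube_mix _ uc vc) (in_cube_mix _ uc vc) _) _.
  by move=> j jp; rewrite /mix ltnS leq_eqVlt (negbTE jp).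
by rewrite /mix ltnSn ltnn.
Qed.

Lemma sl_l1_prefix p u v : (p <= n)%N -> in_cube u -> in_cube v ->
  (forall j, (p <= j < n)%N -> u j = v j) ->
  `|K u - K v| <= \sum_(k < p) L k * `|u k - v k|.
Proof.
move=> pn uc vc uv.
have -> : K u = K (mix p u v).
  apply: (sl_ext KL) => j jn; rewrite /mix; case: ltnP => // pj.
  by rewrite uv// pj.
elim: p pn {uv} => [|p IH] pn; first by rewrite subrr normr0 big_ord0.
rewrite big_ord_recr /= addrC; apply: le_trans (lerD (sl_mix pn uc vc) (IH (ltnW pn))).
by apply: le_trans (ler_normD _ _); rewrite addrA subrK.
Qed.

Lemma sl_l1 u v : in_cube u -> in_cube v ->
  `|K u - K v| <= \sum_(k < n) L k * `|u k - v k|.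
Proof.
move=> uc vc; apply: sl_l1_prefix => // j /andP[nj]; by rewrite ltnNge nj.
Qed.

Definition sl_bound : R := `|K (fun=> 0)| + \sum_(k < n) L k.

Lemma sl_boundP u : in_cube u -> `|K u| <= sl_bound.
Proof.
move=> uc; have zc : in_cube (fun=> 0 : R) by move=> j; rewrite lexx ler01.
rewrite -lerBlDl; apply: le_trans (lerB_dist _ _) _.
apply: le_trans (sl_l1 uc zc) _; apply: ler_sum => k _.
rewrite subr0 -[leRHS]mulr1 ler_wpM2l ?(sl_ge0 KL)//.
by have /andP[h1 h2] := uc k; rewrite ger0_norm.
Qed.

Lemma sl_near_grid u (e : R) : in_cube u -> 0 < e ->
  exists s, \sum_(k < n) L k * `|u k - grid R s k| <= e.
Proof.
move=> uc e0.
have L1 : 0 < 1 + \sum_(k < n) L k.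
  by rewrite ltr_wpDr// sumr_ge0// => k _; exact: sl_ge0 KL k.
have [s hs] := grid_dense n uc (divr_gt0 e0 L1).
exists s; apply: (@le_trans _ _ (\sum_(k < n) L k * (e / (1 + \sum_(k < n) L k)))).
  by apply: ler_sum => k _; rewrite ler_wpM2l ?(sl_ge0 KL)// hs.
rewrite -mulr_suml mulrA ler_pdivrMr// mulrC; apply: ler_wpM2l; first exact: ltW.
by rewrite lerDr.
Qed.

(* McShane's formula: [K] is the infimum over the grid points [v] of
   [K v + \sum_k L k * |u k - v k|]. *)
Lemma measurable_sl (D : set R) (f : R -> nat -> R) :
  (forall j, measurable_fun D (fun x => f x j)) ->
  (forall x, D x -> in_cube (f x)) ->
  measurable_fun D (fun x => K (f x)).
Proof.
move=> mf fc.
(* m is the code of a grid point; a number that codes none gets an upper bound of K, which cannot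
   lower the infimum below K. *)
pose h (m : nat) (x : R) : R :=
  if unpickle m is Some s then
    K (grid R s) + \sum_(k < n) L k * `|f x k - grid R s k|
  else sl_bound.
have hK x m : D x -> K (f x) <= h m x.
  move=> Dx; rewrite /h; case: unpickle => [s|].
    rewrite -lerBlDl (le_trans (ler_norm _))//.
    by apply: sl_l1 => //; [exact: fc|exact: in_cube_grid].
  by rewrite (le_trans (ler_norm _))// sl_boundP//; exact: fc.
have mh m : measurable_fun D (h m).
  rewrite /h; case: unpickle => [s|]; last exact: measurable_cst.
  apply: measurable_funD; first exact: measurable_cst.
  apply: measurable_sum => k; apply: measurable_funM; first exact: measurable_cst.
  apply: measurableT_comp => //; apply: measurable_funB => //.
have hlb x : D x -> has_lbound (range (h^~ x)).
  by move=> Dx; exists (K (f x)) => _ [m _ <-]; exact: hK.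
apply: (eq_measurable_fun (fun x => infs (h^~ x) 0)); last first.
  by apply: measurable_fun_infs.
move=> x /[!inE] Dx; rewrite /infs.
apply/eqP; rewrite eq_le; apply/andP; split.
  apply/ler_addgt0Pr => e e0.
  have [s hs] := sl_near_grid (fc x Dx) (divr_gt0 e0 (ltr0n _ 2)).
  apply: (@le_trans _ _ (h (pickle s) x)).
    apply: ge_inf; last by exists (pickle s).
    by exists (K (f x)) => _ [m _ <-]; exact: hK.
  rewrite /h pickleK.
  have := sl_l1 (fc x Dx) (in_cube_grid R s); rewrite ler_distlC => /andP[_ h1].
  lra.
by apply: lb_le_inf; [exists (h 0%N x), 0%N|move=> _ [m _ <-]; exact: hK].
Qed.

End separately_lipschitz.

(** * Decay of memory and the reverse martingale *)

(** Multiply e^s <= s + e^(3 s^2) by e^g with s = f - g: by the hypothesis the linear term has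
    integral zero. *)
Lemma Ex_expR_le (R : realType) (f g : R -> R) (r : R) : bmeas f -> bmeas g ->
  Ex (fun x => f x * expR (g x)) = Ex (fun x => g x * expR (g x)) ->
  {ae @lebesgue_measure R, forall x, x \in `[0, 1] -> `|f x - g x| <= r} ->
  Ex (fun x => expR (f x)) <= expR (3 * r ^+ 2) * Ex (fun x => expR (g x)).
Proof.
move=> bf bg fg0 fgr; have beg := bmeas_expR bg.
have bfg := bmeasM bf beg; have bgg := bmeasM bg beg.
have be : bmeas (fun x => expR (3 * r ^+ 2) * expR (g x)).
  by apply: bmeasM => //; exact: bmeas_cst.
have bd := bmeasB bfg bgg.
have -> : expR (3 * r ^+ 2) * Ex (fun x => expR (g x)) =
    Ex (fun x => (f x * expR (g x) - g x * expR (g x)) + expR (3 * r ^+ 2) * expR (g x)).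
  by rewrite ExD// ExB// fg0 subrr add0r ExZ.
apply: le_Ex; [exact: bmeas_expR|exact: bmeasD|].
apply: filterS fgr => x h /h{}h.
rewrite -mulrBl -mulrDl -[X in expR X](subrK (g x)) expRD.
apply: ler_wpM2r; first exact: expR_ge0.
apply: le_trans (expR_le_sqr _) _; rewrite lerD2l ler_expR ler_wpM2l//.
by rewrite -real_normK ?num_real// ler_pXn2r ?nnegrE// (le_trans _ h).
Qed.

Section concentration.
Context {R : realType} (T : nat -> pexp_map R) (lam M : R).
Hypotheses (lam1 : 1 < lam) (M0 : 0 <= M)
  (dT : forall n x, pe_dom (T n.+1) x -> lam <= `|derive1 (T n.+1) x|)
  (ddT : forall n x, pe_dom (T n.+1) x -> `|derive1n 2 (T n.+1) x| <= M).
Variables (S theta K0 d : R).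
Hypotheses (S1 : 1 <= S) (hS : forall n, exists (I : finType) (b : I -> branch R),
    branches_ok T lam M n b /\ \sum_j br_W (b j) <= S)
  (theta01 : 0 < theta < 1) (K00 : 0 < K0)
  (dec : forall n l f, (1 <= l)%N -> BV f ->
    (\int[@lebesgue_measure R]_(x in `[0%R, 1%R]) (f x)%:E = 0)%E ->
    (BVnorm (iter_transfer (fun k => T (n + k)%N) l f) <=
      (K0 * theta ^+ l)%:E * BVnorm f)%E)
  (d01 : 0 < d <= 1)
  (hd : forall n, {ae @lebesgue_measure R, forall x, x \in `[0, 1] ->
    d <= iter_transfer T n (cst 1) x}).
Variables (N : nat) (K : (nat -> R) -> R) (L : nat -> R).
Hypothesis KL : sep_lip N K L.

Local Notation Z := (iter_map T).
Local Notation P := (iter_transfer T).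
Local Notation Dl := (distortion lam M).
Definition orbit (x : R) : nat -> R := fun j => Z j x.
Local Notation mu := (@lebesgue_measure R).

Let Dl0 : 0 <= Dl.
Proof.
have l0 : 0 < lam := lt_trans ltr01 lam1.
by rewrite !divr_ge0 ?subr_ge0 ?invf_le1 ?exprn_ge0// ltW.
Qed.

Lemma in_cube_orbit x : x \in `[0, 1] -> in_cube (orbit x).
Proof. by rewrite in_itv/= => x01 j; exact: iter_map01. Qed.

(** The BV bound is S (A + (3 + Dl) B) with A = 2 a_i and B = 2 L_i <= 2 a_i, hence 8 + 2 Dl; K0
    comes from (Dec). *)
Definition memory_const : R := K0 * (S * (8 + 2 * Dl)).
Definition memory (p : nat) : R :=
  memory_const * geo theta (fun i => geo lam^-1 L i.+1) p.

Let lam0 : 0 <= lam^-1.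
Proof. by rewrite invr_ge0 ltW// (lt_trans ltr01). Qed.

Lemma memory_ge0 p : 0 <= memory p.
Proof.
have [theta0 _] := andP theta01.
have S0 : 0 <= S by rewrite (le_trans ler01).
apply: mulr_ge0.
  by apply: mulr_ge0; [exact: ltW|rewrite mulr_ge0// addr_ge0// mulr_ge0].
apply: geo_ge0 => [|i]; first exact: ltW.
by apply: geo_ge0 => // k; exact: sl_ge0 KL k.
Qed.

Lemma bmeas_sl (f : R -> nat -> R) :
  (forall j, measurable_fun (`[0, 1]%classic : set R) (fun x => f x j)) ->
  (forall x, x \in `[0, 1] -> in_cube (f x)) -> bmeas (fun x => K (f x)).
Proof.
move=> mf fc; split; first by apply: (measurable_sl KL).
by exists (sl_bound N K L) => x x01; exact: sl_boundP KL _ (fc x x01).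
Qed.

Lemma bmeas_mix_orbit p u : in_cube u -> bmeas (fun x => K (mix p (orbit x) u)).
Proof.
move=> uc; apply: bmeas_sl => [j|x x01].
  rewrite /mix; case: (j < p)%N; last exact: measurable_cst.
  exact: measurable_iter_map.
by apply: in_cube_mix => //; exact: in_cube_orbit.
Qed.

Definition mean_mix p u : R := Ex (fun x => K (mix p (orbit x) u)).

Section increments.
Variables (u : nat -> R) (uc : in_cube u).

Definition incr i x : R := K (mix i.+1 (orbit x) u) - K (mix i (orbit x) u).

Lemma bmeas_incr i : bmeas (incr i).
Proof. by apply: bmeasB; exact: bmeas_mix_orbit. Qed.

Lemma incr_le i x : (i < N)%N -> x \in `[0, 1] -> `|incr i x| <= L i.
Proof.
move=> iN x01; have oc := in_cube_orbit x01.
apply: le_trans (sl_mix KL iN oc uc) _.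
rewrite -[leRHS]mulr1 ler_wpM2l ?(sl_ge0 KL)//.
have := oc i; have := uc i => /andP[? ?] /andP[? ?].
by rewrite ler_norml; apply/andP; split; lra.
Qed.

Lemma mix_orbit_osc i x y : (i <= N)%N -> x \in `[0, 1] -> y \in `[0, 1] ->
  `|K (mix i (orbit x) u) - K (mix i (orbit y) u)| <=
    \sum_(k < i) L k * `|Z k x - Z k y|.
Proof.
move=> iN x01 y01.
apply: le_trans (sl_l1_prefix KL iN _ _ _) _.
- by apply: in_cube_mix => //; exact: in_cube_orbit.
- by apply: in_cube_mix => //; exact: in_cube_orbit.
- by move=> j /andP[ij _]; rewrite /mix ltnNge ij.
by apply: ler_sum => k _; rewrite /mix ltn_ord.
Qed.

Lemma incr_osc i x y : (i < N)%N -> x \in `[0, 1] -> y \in `[0, 1] ->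
  `|incr i x - incr i y| <= \sum_(k < i.+1) (2 * L k) * `|Z k x - Z k y|.
Proof.
move=> iN x01 y01.
have h1 := mix_orbit_osc iN x01 y01.
have h2 := mix_orbit_osc (ltnW iN) x01 y01.
have -> : \sum_(k < i.+1) (2 * L k) * `|Z k x - Z k y| =
    2 * \sum_(k < i.+1) L k * `|Z k x - Z k y|.
  by rewrite mulr_sumr; apply: eq_bigr => k _; rewrite mulrA.
have h3 : \sum_(k < i) L k * `|Z k x - Z k y| <= \sum_(k < i.+1) L k * `|Z k x - Z k y|.
  by rewrite big_ord_recr/= lerDl mulr_ge0 ?(sl_ge0 KL).
have -> : incr i x - incr i y =
   (K (mix i.+1 (orbit x) u) - K (mix i.+1 (orbit y) u)) -
   (K (mix i (orbit x) u) - K (mix i (orbit y) u)) by rewrite /incr; ring.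
by apply: le_trans (ler_normB _ _) _; lra.
Qed.

Definition cincr i x : R := incr i x - Ex (incr i).

Lemma bmeas_cincr i : bmeas (cincr i).
Proof. by apply: bmeasB; [exact: bmeas_incr|exact: bmeas_cst]. Qed.

Lemma cincr_transfer i p : (i < p)%N -> (i < N)%N ->
  {ae mu, forall x, x \in `[0, 1] ->
    `|P p (cincr i) x| <= memory_const * (theta ^+ (p.-1 - i) * geo lam^-1 L i.+1)}.
Proof.
move=> ip iN; have [theta0 theta1] := andP theta01.
have [I [b [bok bS]]] := hS i.
have Li := sl_ge0 KL.
have bc := bmeas_cincr i.
have cB x : x \in `[0, 1] -> `|cincr i x| <= 2 * L i.
  move=> x01; apply: le_trans (ler_normB _ _) _.
  have := incr_le iN x01; have := norm_Ex_le (bmeas_incr i) (fun x => incr_le iN (x := x)).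
  lra.
have a0 j : 0 <= 2 * L j by rewrite mulr_ge0.
have fa x y : x \in `[0, 1] -> y \in `[0, 1] ->
    `|cincr i x - cincr i y| <= \sum_(k < i.+1) (2 * L k) * `|Z k x - Z k y|.
  move=> x01 y01; rewrite /cincr (_ : _ - _ - _ = incr i x - incr i y); last by ring.
  exact: incr_osc.
have bv := iter_transfer_BVnorm_le lam1 M0 dT ddT bok bS bc cB a0 fa.
have BVc := iter_transfer_BV lam1 M0 dT ddT bok bS bc cB a0 fa.
have E0 : (\int[mu]_(x in `[0%R, 1%R]) (P i (cincr i) x)%:E = 0)%E.
  have bP := bmeas_iter_transfer lam1 dT ddT i bc.
  rewrite (Ex_int bP) (Ex_iter_transfer lam1 dT ddT)// ExB; last exact: bmeas_cst.
    by rewrite Ex_cst subrr.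
  exact: bmeas_incr.
have p_i : (1 <= p - i)%N by rewrite subn_gt0.
have := dec i p_i BVc E0.
rewrite -iter_transfer_shift subnKC; last exact: ltnW.
move=> h; apply: ae_le_BVnorm.
  by have [] := bmeas_iter_transfer lam1 dT ddT p bc.
apply: le_trans h _.
have Kt : 0 <= K0 * theta ^+ (p - i) by rewrite mulr_ge0 ?exprn_ge0// ltW.
apply: le_trans (lee_wpmul2l _ bv) _; first by rewrite lee_fin.
rewrite -EFinM lee_fin.
have AE : \sum_(j < i.+1) 2 * L j * lam ^- (i - j) = 2 * geo lam^-1 L i.+1.
  rewrite geoE mulr_sumr; apply: eq_bigr => j _.
  by rewrite -mulrA (mulrC (L j)) exprVn.
have LiG : L i <= geo lam^-1 L i.+1 by rewrite /= lerDr mulr_ge0 ?geo_ge0.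
rewrite AE /memory_const.
(* (Dec) gives theta^(p-i); the surplus factor theta is bounded by 1 to match [geo]. *)
have -> : (p - i)%N = (p.-1 - i).+1 by case: p ip {p_i Kt} => // p ip; rewrite subSn.
rewrite exprS.
set G := geo _ _ _ in LiG *; set t := theta ^+ _.
have t0 : 0 <= t by rewrite exprn_ge0// ltW.
have S0 : 0 <= S by rewrite (le_trans ler01).
have G0 : 0 <= G := le_trans (Li i) LiG.
have -> : K0 * (S * (8 + 2 * Dl)) * (t * G) = (K0 * t) * (S * ((8 + 2 * Dl) * G)) by ring.
apply: ler_pM.
- by rewrite !mulr_ge0// ltW.
- by rewrite mulr_ge0//; have := mulr_ge0 Dl0 (Li i); have := Li i; lra.
- by apply: ler_wpM2l; [exact: ltW|apply: ler_piMl => //; exact: ltW].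
- by apply: ler_wpM2l => //; have := ler_wpM2l Dl0 LiG; lra.
Qed.

(** Telescoping; the sum starts at 0 because [mix 0] is u itself, which does not depend on x and so
    equals its mean. *)
Lemma sum_cincr p x : K (mix p (orbit x) u) - mean_mix p u = \sum_(i < p) cincr i x.
Proof.
elim: p => [|p IH].
  rewrite big_ord0 /mean_mix (_ : (fun=> _) = fun=> K (mix 0 (orbit x) u)) ?Ex_cst ?subrr//.
rewrite big_ord_recr /= -IH /cincr /incr ExB; try exact: bmeas_mix_orbit.
by rewrite /mean_mix; ring.
Qed.

End increments.

Lemma mix_transfer p u : (p <= N)%N -> in_cube u -> {ae mu, forall x, x \in `[0, 1] ->
  `|P p (fun y => K (mix p (orbit y) u)) x - P p (cst 1) x * mean_mix p u| <= memory p}.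
Proof.
move=> pN uc; have [I [b [[bo PE] _]]] := hS p.
have h : {ae mu, forall x, forall i : 'I_p, x \in `[0, 1] ->
    `|P p (cincr u i) x| <= memory_const * (theta ^+ (p.-1 - i) * geo lam^-1 L i.+1)}.
  apply: filter_forall => i; apply: cincr_transfer => //.
  exact: leq_trans (ltn_ord i) pN.
apply: filterS2 h (@ae_oo01 R) => x h /[swap] x01 /(_ x01) x01'.
rewrite !PE// (_ : _ - _ = \sum_(i < p) P p (cincr u i) x); last first.
  under [RHS]eq_bigr do rewrite PE//.
  rewrite exchange_big/= mulr_suml -sumrB; apply: eq_bigr => j _.
  by rewrite -mulr_sumr -sum_cincr// mulr1 mulrBr.
rewrite /memory geoE mulr_sumr; apply: le_trans (ler_norm_sum _ _ _) _.
by apply: ler_sum => i _; exact: h.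
Qed.

Lemma mix_tail_lip p o u v : in_cube o -> in_cube u -> in_cube v ->
  `|K (mix p o u) - K (mix p o v)| <= \sum_(k < N) L k * `|u k - v k|.
Proof.
move=> oc uc vc; apply: le_trans (sl_l1 KL _ _) _; try exact: in_cube_mix.
apply: ler_sum => k _; apply: ler_wpM2l; first exact: sl_ge0 KL k.
by rewrite /mix; case: ifP => // _; rewrite subrr normr0.
Qed.

Lemma mean_mix_lip p u v : in_cube u -> in_cube v ->
  `|mean_mix p u - mean_mix p v| <= \sum_(k < N) L k * `|u k - v k|.
Proof.
move=> uc vc; rewrite /mean_mix -ExB; try exact: bmeas_mix_orbit.
apply: norm_Ex_le; first by apply: bmeasB; exact: bmeas_mix_orbit.
by move=> x x01; apply: mix_tail_lip => //; exact: in_cube_orbit.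
Qed.

(** At a fixed x both terms are Lipschitz in u for the weighted l^1 distance, so the estimate passes
    from the countable grid to every u outside one null set. *)
Lemma mix_transfer_all p : (p <= N)%N -> {ae mu, forall x, x \in `[0, 1] ->
  forall u, in_cube u ->
  `|P p (fun y => K (mix p (orbit y) u)) x - P p (cst 1) x * mean_mix p u| <= memory p}.
Proof.
move=> pN; have [I [b [[bo PE] _]]] := hS p.
have h : {ae mu, forall x, forall m : nat, x \in `[0, 1] ->
    if unpickle m is Some s then
      `|P p (fun y => K (mix p (orbit y) (grid R s))) x -
        P p (cst 1) x * mean_mix p (grid R s)| <= memory p
    else true}.
  apply: ae_foralln => m; case: unpickle => [s|]; last exact: aeW.
  by apply: mix_transfer => //; exact: in_cube_grid.
apply: filterS2 h (@ae_oo01 R) => x h /[swap] x01 /(_ x01) x01' u uc.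
pose w := \sum_j br_w (b j) x.
have w0 : 0 <= w by apply: sumr_ge0 => j _; exact: bo_w0 (bo j) x.
pose phi v := P p (fun y => K (mix p (orbit y) v)) x - P p (cst 1) x * mean_mix p v.
have phiE v : phi v = \sum_j br_w (b j) x *
    (K (mix p (orbit (br_sg (b j) x)) v) - mean_mix p v).
  rewrite /phi !PE// mulr_suml -sumrB; apply: eq_bigr => j _.
  by rewrite mulr1 mulrBr.
apply/ler_addgt0Pr => e e0.
have w1 : 0 < 2 * w + 1 by lra.
have [s hs] := sl_near_grid KL uc (divr_gt0 e0 w1).
have gc := in_cube_grid R s.
have := h (pickle s) x01; rewrite pickleK -/(phi (grid R s)) -/(phi u) => h1.
have h2 : `|phi u - phi (grid R s)| <= w * (2 * (e / (2 * w + 1))).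
  rewrite !phiE -sumrB; apply: le_trans (ler_norm_sum _ _ _) _.
  rewrite mulr_suml; apply: ler_sum => j _.
  rewrite -mulrBr normrM ger0_norm ?(bo_w0 (bo j))//.
  apply: ler_wpM2l; first exact: bo_w0 (bo j) x.
  have oc := in_cube_orbit (bo_sg01 (bo j) x).
  have h3 := mix_tail_lip p oc uc gc; have h4 := mean_mix_lip p uc gc.
  have -> (x1 x2 x3 x4 : R) : x1 - x2 - (x3 - x4) = (x1 - x3) - (x2 - x4) by ring.
  apply: le_trans (ler_normB _ _) _; lra.
have h3 : w * (2 * (e / (2 * w + 1))) <= e.
  by rewrite !mulrA ler_pdivrMr//; lra.
rewrite -(subrK (phi (grid R s)) (phi u)); apply: le_trans (ler_normD _ _) _; lra.
Qed.

(** Z_p is nonsingular: the preimage of A has measure equal to the integral of P_1^p (1_A \o Z_p),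
    which vanishes off A. *)
Lemma ae_orbit p (Q : R -> Prop) :
  {ae mu, forall x, x \in `[0, 1] -> Q x} ->
  {ae mu, forall x, x \in `[0, 1] -> Q (Z p x)}.
Proof.
have [I [b [[bo PE] _]]] := hS p.
move=> [A [mA A0 QA]].
have mZ := measurable_iter_map T p.
have Z01 x : x \in `[0, 1] -> Z p x \in `[0, 1].
  by rewrite !in_itv/=; exact: iter_map01.
have bA : bmeas (fun x => \1_A (Z p x) : R).
  split; first by apply: measurable_comp01 => //; exact: measurable_indic.
  by exists 1 => x _; rewrite indicE; case: (_ \in _); rewrite ?normr1 ?normr0.
exists (`[0, 1]%classic `&` Z p @^-1` A); split.
- exact: mZ.
- have mB : measurable (`[0, 1]%classic `&` Z p @^-1` A : set (measurableTypeR R)).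
    exact: mZ.
  have -> : `[0, 1]%classic `&` Z p @^-1` A = (`[0, 1]%classic `&` Z p @^-1` A) `&` `[0, 1]%classic.
    by rewrite setIAC setIid.
  rewrite -integral_indic//.
  transitivity (\int[mu]_(x in `[0%R, 1%R]) (\1_A (Z p x) : R)%:E)%E.
    apply: eq_integral => x; rewrite inE => x01; rewrite !indicE; congr (_%:R%:E).
    by congr nat_of_bool; apply/idP/idP; rewrite !inE => //; case.
  rewrite Ex_int// -(Ex_iter_transfer lam1 dT ddT p)//.
  congr EFin; rewrite -(Ex_cst (0 : R)); apply/eqP; rewrite eq_le.
  have bP := bmeas_iter_transfer lam1 dT ddT p bA.
  have P0 : {ae mu, forall x, x \in `[0, 1] -> P p (fun x => \1_A (Z p x) : R) x = 0}.
    have A0' : {ae mu, forall x, ~ A x} by exists A; split=> // x /contrapT.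
    apply: filterS2 A0' (@ae_oo01 R) => x nA h /h x01; rewrite PE// big1// => j _.
    have [->|/(bo_supp (bo j)) lxu] := eqVneq (br_w (b j) x) 0; first by rewrite mul0r.
    by rewrite (bo_Z (bo j) lxu) indicE memNset ?mulr0.
  apply/andP; split; apply: le_Ex => //; try exact: bmeas_cst;
    by apply: filterS P0 => x h /h ->.
- move=> x /not_implyP[x01 nQ]; split => //; apply: QA => /(_ (Z01 x x01)).
  exact: nQ.
Qed.

Lemma bmeas_orbit : bmeas (fun x => K (orbit x)).
Proof.
apply: bmeas_sl => [j|]; first exact: measurable_iter_map.
exact: in_cube_orbit.
Qed.

(** Stands for measurability with respect to Z_p, without naming a sigma-algebra. *)
Definition fibre_constant p (g : R -> R) : Prop := forall x x',
  x \in `[0, 1] -> x' \in `[0, 1] -> Z p x = Z p x' -> g x = g x'.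

Lemma fibre_constantS p g : fibre_constant p.+1 g -> fibre_constant p g.
Proof. by move=> h x x' x01 x'01 e; apply: h => //=; rewrite e. Qed.

Lemma conditional_mean p : (p <= N)%N -> exists Y : R -> R,
  [/\ bmeas Y, fibre_constant p Y,
      {ae mu, forall x, x \in `[0, 1] -> `|Y x - mean_mix p (orbit x)| <= memory p / d} &
      forall g, bmeas g -> fibre_constant p g ->
        Ex (fun x => Y x * g x) = Ex (fun x => K (orbit x) * g x)].
Proof.
move=> pN; have [I [b [[bo PE] _]]] := hS p; have [d0 d1] := andP d01.
pose Nm x := \sum_j br_w (b j) (Z p x) * K (mix p (orbit (br_sg (b j) (Z p x))) (orbit x)).
pose Dn x := \sum_j br_w (b j) (Z p x).
(* [Dn] is P_1^p 1 at Z_p. Where it vanishes the quotient is 0, so Y is bounded everywhere. *)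
pose Y x := Nm x / Dn x.
have Z01 x : x \in `[0, 1] -> Z p x \in `[0, 1].
  by rewrite !in_itv/=; exact: iter_map01.
have oc := in_cube_orbit.
have bS0 := bo_sg01.
have Dn0 x : 0 <= Dn x by apply: sumr_ge0 => j _; exact: bo_w0 (bo j) _.
have mw j : measurable_fun (`[0, 1]%classic : set R) (fun x => br_w (b j) (Z p x)).
  by apply: measurableT_comp; [exact: bo_mw (bo j)|exact: measurable_iter_map].
have msg j : measurable_fun (`[0, 1]%classic : set R) (fun x => br_sg (b j) (Z p x)).
  by apply: measurableT_comp; [exact: bo_msg (bo j)|exact: measurable_iter_map].
have mixc j x : x \in `[0, 1] -> in_cube (mix p (orbit (br_sg (b j) (Z p x))) (orbit x)).
  by move=> x01; apply: in_cube_mix; apply: oc => //; exact: bo_sg01 (bo j) _.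
have tail x x' k : Z p x = Z p x' -> (p <= k)%N -> Z k x = Z k x'.
  move=> e; elim: k => [|k IH]; first by rewrite leqn0 => /eqP p0; rewrite -p0.
  by rewrite leq_eqVlt => /orP[/eqP<-//|/IH/= ->].
have Ytail : fibre_constant p Y.
  move=> x x' _ _ e; rewrite /Y /Nm /Dn e; congr (_ / _); apply: eq_bigr => j _.
  congr (_ * _); apply: (sl_ext KL) => k _; rewrite /mix; case: ltnP => // pk.
  exact: tail.
have bY : bmeas Y.
  split.
    apply: measurable_funM; last first.
      rewrite (_ : (fun x => _) = (fun x => Dn x `^ (-1))); last first.
        by apply/funext => x; rewrite powR_inv1.
      by apply: (measurableT_comp (measurable_powR _)); exact: measurable_sum.
    apply: measurable_sum => j; apply: measurable_funM => //.
    apply: (measurable_sl KL) => [k|]; last exact: mixc.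
    rewrite /mix; case: (k < p)%N; last exact: measurable_iter_map.
    apply: measurable_comp01 => //; first exact: measurable_iter_map.
    by move=> x _; exact: bo_sg01 (bo j) _.
  exists (sl_bound N K L) => x x01; rewrite /Y normrM normfV (ger0_norm (Dn0 x)).
  have [D0|D0] := eqVneq (Dn x) 0.
    rewrite D0 invr0 mulr0; apply: le_trans (normr_ge0 (K (orbit x))) _.
    by apply: (sl_boundP KL); exact: oc.
  rewrite ler_pdivrMr ?lt_def ?D0 ?Dn0//; apply: le_trans (ler_norm_sum _ _ _) _.
  rewrite mulr_sumr; apply: ler_sum => j _.
  rewrite normrM ger0_norm ?(bo_w0 (bo j))// mulrC ler_wpM2r ?(bo_w0 (bo j))//.
  by apply: (sl_boundP KL); exact: mixc.
have bK := bmeas_orbit.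
exists Y; split => //.
- have h1 := ae_orbit p (mix_transfer_all pN).
  have h2 := ae_orbit p (hd p); have h3 := ae_orbit p (@ae_oo01 R).
  apply: filterS3 h1 h2 h3 => x h1 h2 h3 x01.
  have := h1 x01 _ (oc _ x01); have := h2 x01; have := h3 x01 => z01.
  have DE : P p (cst 1) (Z p x) = Dn x by rewrite PE//; apply: eq_bigr => j _; rewrite mulr1.
  rewrite DE PE// -/(Nm x) => dD hN.
  have Dx : 0 < Dn x := lt_le_trans d0 dD.
  have -> : Y x - mean_mix p (orbit x) = (Nm x - Dn x * mean_mix p (orbit x)) / Dn x.
    by rewrite /Y; field; rewrite gt_eqF.
  rewrite normrM normfV (gtr0_norm Dx) ler_pdivrMr//.
  apply: le_trans hN _; rewrite -mulrA ler_peMr ?memory_ge0//.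
  by rewrite mulrC ler_pdivlMr ?mul1r.
- move=> g bg gf.
  have bYg := bmeasM bY bg; have bKg := bmeasM bK bg.
  rewrite -(Ex_iter_transfer lam1 dT ddT p bYg) -(Ex_iter_transfer lam1 dT ddT p bKg).
  (* The two transfers agree pointwise: over the fibre of z the functions Y, g and the tail from
     time p on are constant, and Y times the total weight is the weighted sum of K. *)
  suff h z : 0 < z < 1 -> P p (fun x => Y x * g x) z = P p (fun x => K (orbit x) * g x) z.
    apply/eqP; rewrite eq_le; apply/andP; split; apply: le_Ex;
      try exact: (bmeas_iter_transfer lam1 dT ddT);
      by apply: filterS (@ae_oo01 R) => x hx /hx /h ->.
  move=> z01; rewrite !PE//.
  have [[i wi]|nw] := pselect (exists i, br_w (b i) z != 0); last first.
    have w0 j : br_w (b j) z = 0.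
      by apply/eqP; apply: contrapT => /negP wj; apply: nw; exists j.
    by apply: eq_bigr => j _; rewrite w0 !mul0r.
  have Zz j : br_w (b j) z != 0 -> Z p (br_sg (b j) z) = z.
    by move=> /(bo_supp (bo j)); exact: bo_Z (bo j) z.
  set x0 := br_sg (b i) z.
  have x001 : x0 \in `[0, 1] := bo_sg01 (bo i) z.
  have Dz : Dn x0 != 0.
    rewrite /Dn (Zz _ wi) psumr_neq0 => [|j _]; last exact: bo_w0 (bo j) z.
    by apply/hasP; exists i; rewrite ?mem_index_enum//= lt_def wi (bo_w0 (bo i)).
  have -> : \sum_j br_w (b j) z * (Y (br_sg (b j) z) * g (br_sg (b j) z)) =
      \sum_j br_w (b j) z * (Y x0 * g x0).
    apply: eq_bigr => j _; have [->|wj] := eqVneq (br_w (b j) z) 0; first by rewrite !mul0r.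
    have e : Z p (br_sg (b j) z) = Z p x0 by rewrite !Zz.
    by rewrite (Ytail _ _ (bo_sg01 (bo j) z) x001 e) (gf _ _ (bo_sg01 (bo j) z) x001 e).
  rewrite -mulr_suml mulrA.
  have -> : \sum_j br_w (b j) z = Dn x0 by rewrite /Dn (Zz _ wi).
  rewrite [Dn x0 * _]mulrC /Y divfK// /Nm (Zz _ wi) mulr_suml; apply: eq_bigr => j _.
  have [->|wj] := eqVneq (br_w (b j) z) 0; first by rewrite !mul0r.
  have e : Z p (br_sg (b j) z) = Z p x0 by rewrite !Zz.
  rewrite -mulrA (gf _ _ (bo_sg01 (bo j) z) x001 e); congr (_ * (_ * _)).
  apply: (sl_ext KL) => k _; rewrite /mix; case: ltnP => // pk.
  by rewrite /orbit; apply/esym; exact: tail.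
Qed.

(** R_p of the overview: Y_p and Y_(p+1) are compared with their means, and the two means differ
    only through coordinate p. *)
Definition step_bound p : R := (memory p + memory p.+1) / d + L p.

Lemma mean_mixS p u : (p < N)%N -> in_cube u ->
  `|mean_mix p u - mean_mix p.+1 u| <= L p.
Proof.
move=> pN uc; rewrite distrC /mean_mix -ExB; try exact: bmeas_mix_orbit.
apply: norm_Ex_le; first exact: bmeas_incr.
by move=> x x01; exact: incr_le.
Qed.

Lemma exp_moment :
  Ex (fun x => expR (K (orbit x))) <= expR (Ex (fun x => K (orbit x)) +
    3 * (\sum_(p < N) step_bound p ^+ 2 + (memory N / d) ^+ 2)).
Proof.
have bK := bmeas_orbit.
have /choice[Y hY] : forall p, exists Y : R -> R, (p <= N)%N ->
  [/\ bmeas Y, fibre_constant p Y,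
      {ae mu, forall x, x \in `[0, 1] -> `|Y x - mean_mix p (orbit x)| <= memory p / d} &
      forall g, bmeas g -> fibre_constant p g ->
        Ex (fun x => Y x * g x) = Ex (fun x => K (orbit x) * g x)].
  move=> p; have [pN|] := boolP (p <= N)%N; last by exists (cst 0).
  by have [Y hY] := conditional_mean pN; exists Y.
have fibre_exp p g : fibre_constant p g -> fibre_constant p (fun x => expR (g x)).
  by move=> gc x x' x01 x'01 e; rewrite (gc x x').
set kappa := Ex (fun x => K (orbit x)).
have step p : (p <= N)%N -> Ex (fun x => expR (K (orbit x))) <=
    expR (3 * \sum_(i < p) step_bound i ^+ 2) * Ex (fun x => expR (Y p x)).
  elim: p => [|p IH] pN.
    have [bY _ hd0 _] := hY 0%N pN.
    rewrite big_ord0 mulr0 expR0 mul1r; apply: le_Ex; [exact: bmeas_expR|exact: bmeas_expR|].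
    (* [memory 0] is 0, so Y_0 equals K of the orbit almost everywhere. *)
    apply: filterS hd0 => x h /h; rewrite /memory /= mulr0 mul0r normr_le0 subr_eq0.
    rewrite /mean_mix (_ : (fun=> _) = fun=> K (orbit x))// Ex_cst => /eqP ->.
    exact: lexx.
  apply: le_trans (IH (ltnW pN)) _.
  have [bY fY dY eY] := hY p (ltnW pN); have [bY' fY' dY' eY'] := hY p.+1 pN.
  rewrite big_ord_recr/= mulrDr expRD -mulrA; apply: ler_wpM2l; first exact: expR_ge0.
  apply: Ex_expR_le => //.
    (* Y_p and Y_(p+1) have the same integral against e^(Y_(p+1)), which is constant on the fibres
       of Z_(p+1) and hence on those of Z_p. *)
    rewrite eY ?eY'//; try exact: bmeas_expR; first exact: fibre_exp.
    by apply: fibre_exp; exact: fibre_constantS.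
  apply: filterS2 dY dY' => x h h' x01.
  have h1 := h x01; have h2 := h' x01; have h3 := mean_mixS pN (in_cube_orbit x01).
  rewrite /step_bound mulrDl.
  rewrite (_ : Y p x - Y p.+1 x = (Y p x - mean_mix p (orbit x)) +
    (mean_mix p (orbit x) - mean_mix p.+1 (orbit x)) - (Y p.+1 x - mean_mix p.+1 (orbit x))); last by ring.
  apply: le_trans (ler_normB _ _) _.
  have := ler_normD (Y p x - mean_mix p (orbit x)) (mean_mix p (orbit x) - mean_mix p.+1 (orbit x)).
  lra.
apply: le_trans (step N (leqnn N)) _.
(* For p = N the mean no longer sees the tail, so Y_N is compared with the constant kappa; this is
   the last square in the bound. *)
have [bY fY dY eY] := hY N (leqnn N).
rewrite mulrDr addrCA expRD; apply: ler_wpM2l; first exact: expR_ge0.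
rewrite addrC expRD -[X in _ * X]Ex_cst.
apply: Ex_expR_le => //; first exact: bmeas_cst.
  rewrite eY//; last exact: bmeas_cst.
  under eq_Ex do rewrite mulrC.
  by rewrite [RHS]Ex_cst ExZ// mulrC.
apply: filterS dY => x h x01; have := h x01; congr (`|_ - _| <= _).
rewrite /mean_mix; apply: eq_Ex => y _; apply: (sl_ext KL) => j jN.
by rewrite /mix jN.
Qed.

(** [memory] is a double geometric convolution of L; Young's inequality is applied once with theta
    and once with 1/lam. *)
Lemma sum_memory : \sum_(p < N.+1) memory p ^+ 2 <=
  memory_const ^+ 2 * ((1 - theta) ^- 2 * ((1 - lam^-1) ^- 2 * \sum_(i < N) L i ^+ 2)).
Proof.
rewrite (eq_bigr (fun p : 'I_N.+1 => memory_const ^+ 2 *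
  geo theta (fun i => geo lam^-1 L i.+1) p ^+ 2)); last by move=> p _; rewrite exprMn.
rewrite -mulr_sumr; apply: ler_wpM2l; first exact: sqr_ge0.
apply: le_trans (young_geo _ _ theta01) _.
have [_ theta1] := andP theta01.
apply: ler_wpM2l; first by rewrite invr_ge0 sqr_ge0.
have lam01 : 0 < lam^-1 < 1.
  by rewrite invr_gt0 invf_lt1 ?lam1 ?andbT// (lt_trans ltr01).
apply: le_trans (young_geo N L lam01).
by rewrite [leRHS]big_ord_recl/= lerDr sqr_ge0.
Qed.

Lemma exp_concentration :
  Ex (fun x => expR (K (orbit x) - Ex (fun x => K (orbit x)))) <=
  expR (3 * (7 * (memory_const / d) ^+ 2 * (1 - theta) ^- 2 * (1 - lam^-1) ^- 2 + 3) *
    \sum_(i < N) L i ^+ 2).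
Proof.
set kappa := Ex (fun x => K (orbit x)).
have -> : Ex (fun x => expR (K (orbit x) - kappa)) =
    expR (- kappa) * Ex (fun x => expR (K (orbit x))).
  rewrite -ExZ; last exact: bmeas_expR bmeas_orbit.
  by apply: eq_Ex => x _; rewrite -expRD addrC.
apply: le_trans (ler_wpM2l (expR_ge0 _) exp_moment) _.
rewrite -expRD addKr ler_expR -mulrA; apply: ler_wpM2l => //.
(* The square of a sum of three terms is at most 3 times the sum of squares. Summed, the two memory
   terms cost at most 3 D each and the final square at most D, whence the 7. *)
have sb p : step_bound p ^+ 2 <=
    3 * (memory p / d) ^+ 2 + 3 * (memory p.+1 / d) ^+ 2 + 3 * L p ^+ 2.
  rewrite /step_bound mulrDl.
  set x := _ / d; set y := _ / d; set z := L p.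
  have := sqr_ge0 (x - y); have := sqr_ge0 (x - z); have := sqr_ge0 (y - z); lra.
set D := \sum_(p < N.+1) (memory p / d) ^+ 2.
have DN : D = \sum_(p < N) (memory p / d) ^+ 2 + (memory N / d) ^+ 2.
  by rewrite /D big_ord_recr.
have D0 : D = (memory 0 / d) ^+ 2 + \sum_(p < N) (memory p.+1 / d) ^+ 2.
  by rewrite /D big_ord_recl.
have Dle : D <= (memory_const / d) ^+ 2 * ((1 - theta) ^- 2 * ((1 - lam^-1) ^- 2 * \sum_(i < N) L i ^+ 2)).
  rewrite /D (eq_bigr (fun p : 'I_N.+1 => d ^- 2 * memory p ^+ 2)); last first.
    by move=> p _; rewrite exprMn exprVn mulrC.
  rewrite -mulr_sumr exprMn exprVn (mulrC (_ ^+ 2)) -mulrA; apply: ler_wpM2l sum_memory.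
  by rewrite invr_ge0 sqr_ge0.
have : \sum_(p < N) step_bound p ^+ 2 <= \sum_(p < N) (3 * (memory p / d) ^+ 2 +
    3 * (memory p.+1 / d) ^+ 2 + 3 * L p ^+ 2) by apply: ler_sum => p _; exact: sb.
rewrite !big_split/= -!mulr_sumr => hs.
have h1 := sqr_ge0 (memory 0 / d); have h2 := sqr_ge0 (memory N / d).
have h3 : 0 <= \sum_(p < N) (memory p / d) ^+ 2 by apply: sumr_ge0 => p _; exact: sqr_ge0.
set A := (memory_const / d) ^+ 2 in Dle *; set B := (1 - theta) ^- 2 in Dle *.
set E := (1 - lam^-1) ^- 2 in Dle *; set X := \sum_(i < N) L i ^+ 2 in Dle hs *.
have -> : (7 * A * B * E + 3) * X = 7 * (A * (B * (E * X))) + 3 * X by ring.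
lra.
Qed.

End concentration.

(** * From row vectors with least Lipschitz constants to functions of sequences *)

Section lip.
Context {R : realType} (n : nat) (K : 'rV[R]_n -> R).
Hypothesis Ksl : separately_lipschitz K.

Lemma Lip_ge0 i : 0 <= Lip K i.
Proof.
apply: lb_le_inf; first exact: Ksl i.
move=> l lK.
(* The origin and the i-th unit vector differ by 1 in coordinate i alone, so any admissible constant
   is at least an absolute value. *)
have := lK 0 (delta_mx 0 i); rewrite !mxE !eqxx sub0r normrN normr1 mulr1 => h.
apply: le_trans (normr_ge0 _) (h _ _ _) => j.
- by rewrite !mxE in_itv/= lexx ler01.
- by rewrite !mxE in_itv/=; case: (j == i); rewrite /= ?lexx ?ler01.
- by move=> /negbTE ji; rewrite !mxE ji andbF.
Qed.

Lemma lip_bound_Lip i : lip_bound K i (Lip K i).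
Proof.
move=> x y x01 y01 xy; have [l0 hl0] := Ksl i.
have [e|ne] := eqVneq (x 0 i) (y 0 i).
  by have := hl0 _ _ x01 y01 xy; rewrite e subrr normr0 !mulr0.
rewrite -ler_pdivrMr ?normr_gt0 ?subr_eq0//; apply: lb_le_inf; first by exists l0.
by move=> l lK; rewrite ler_pdivrMr ?normr_gt0 ?subr_eq0//; exact: lK.
Qed.

Lemma sep_lip_row : sep_lip n (fun u => K (\row_(j < n) u j))
  (fun k => if insub k is Some i then Lip K i else 0).
Proof.
split=> [k|k u v kn uc vc uv|u v uv].
- by case: insub => // i; exact: Lip_ge0.
- rewrite insubT; have := @lip_bound_Lip (Sub k kn) (\row_j u j) (\row_j v j).
  rewrite !mxE; apply => j; rewrite ?mxE ?in_itv/=; [exact: uc|exact: vc|].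
  by move=> jk; apply: uv; apply: contra jk => /eqP jk; apply/eqP/val_inj.
- by congr K; apply/rowP => j; rewrite !mxE uv.
Qed.

End lip.

Theorem theorem3 (R : realType) (C : set (pexp_map R))
  (hD : exists2 r : nat, (1 <= r)%N & cond_D C r)
  (hDec : cond_Dec C)
  (hder : exists lambda M : R,
    [/\ 1 < lambda, 1 <= M &
        forall T : pexp_map R, C T ->
          (lambda%:E <= ereal_inf [set `|derive1 T x|%:E | x in pe_dom T])%E /\
          (ereal_sup [set `|derive1n 2 T x|%:E | x in pe_dom T] <= M%:E)%E])
  (hcard : exists2 N : nat, (1 <= N)%N &
    forall T : pexp_map R, C T -> (pe_card T <= N)%N)
  (T : nat -> pexp_map R)
  (hT : forall n : nat, (1 <= n)%N -> C (T n))
  (hMin : cond_Min T) :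
  exists2 c : R, 0 < c &
    forall (n : nat) (K : 'rV[R]_n -> R), (1 <= n)%N ->
      separately_lipschitz K ->
      (\int[@lebesgue_measure R]_(x in `[0%R, 1%R])
         (expR (K (process T n x) -
                \int[@lebesgue_measure R]_(y in `[0%R, 1%R])
                   K (process T n y)))%:E
       <= (expR (c * \sum_(j < n) Lip K j ^+ 2))%:E)%E.
Proof.
have [r r1 hDr] := hD; have [theta [K0 [theta01 K00 hdec]]] := hDec.
have [lam [M [lam1 M1 hlM]]] := hder; have [N0 _ hN] := hcard.
have [delta delta0 hdelta] := hMin.
have CT n : C (T n.+1) by exact: hT.
have M0 : 0 <= M := le_trans ler01 M1.
have dT n x : pe_dom (T n.+1) x -> lam <= `|derive1 (T n.+1) x|.
  move=> xT; rewrite -lee_fin; apply: le_trans (hlM _ (CT n)).1 _.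
  by apply: ereal_inf_lbound; exists x.
have ddT n x : pe_dom (T n.+1) x -> `|derive1n 2 (T n.+1) x| <= M.
  move=> xT; rewrite -lee_fin; apply: le_trans _ (hlM _ (CT n)).2.
  by apply: ereal_sup_ubound; exists x.
have [B B0 hB] := cond_D_density_bound lam1 M0 dT ddT r1 hDr CT.
have [S S1 hS] := branches_bounded lam1 M0 dT ddT B0 (fun n => hN _ (CT n)) hB.
have dec n l f : (1 <= l)%N -> BV f ->
    (\int[@lebesgue_measure R]_(x in `[0%R, 1%R]) (f x)%:E = 0)%E ->
    (BVnorm (iter_transfer (fun k => T (n + k)%N) l f) <=
      (K0 * theta ^+ l)%:E * BVnorm f)%E.
  move=> l1 bvf f0; apply: hdec => // k /andP[k1 _].
  by apply: hT; rewrite addn_gt0 k1 orbT.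
(* (Min) starts at n = 1; at n = 0 the density is 1, so the lower bound is cut off at 1. *)
pose d := Num.min delta 1.
have d01 : 0 < d <= 1 by rewrite lt_min delta0 ltr01 ge_min lexx orbT.
have hd n : {ae @lebesgue_measure R, forall x, x \in `[0, 1] ->
    d <= iter_transfer T n (cst 1) x}.
  case: n => [|n]; first by apply: aeW => x _ /=; rewrite ge_min lexx orbT.
  apply: filterS (hdelta n.+1 isT) => x h /h; apply: le_trans.
  by rewrite ge_min lexx.
set c := 3 * (7 * (memory_const lam M S K0 / d) ^+ 2 * (1 - theta) ^- 2 *
  (1 - lam^-1) ^- 2 + 3).
exists c.
  rewrite /c mulr_gt0// ltr_wpDl//.
  apply: mulr_ge0; last by rewrite invr_ge0 sqr_ge0.
  apply: mulr_ge0; last by rewrite invr_ge0 sqr_ge0.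
  by apply: mulr_ge0; rewrite ?sqr_ge0.
move=> n K _ Ksl.
have KL := sep_lip_row Ksl.
have h := exp_concentration lam1 M0 dT ddT S1 hS theta01 K00 dec d01 hd KL.
have bK := bmeas_orbit T KL.
rewrite Ex_int; last first.
  by apply: bmeas_expR; apply: bmeasB; [exact: bK|exact: bmeas_cst].
rewrite lee_fin; apply: le_trans h _; rewrite -/c ler_expR.
by rewrite (eq_bigr (fun i => Lip K i ^+ 2))// => i _; rewrite valK.
Qed.
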